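(* Let $f(z)=z+a_2z^2+a_3z^3+\cdots$ belong to the class $\mathcal{S}_G^{\ast}$. Then $$|a_n|\le \frac{1}{2(n-1)}\quad (n=2,3,4,5),\qquad |a_6|\le \frac{13}{48}.$$ The estimates for $|a_2|,|a_3|,|a_4|,|a_5|$ are sharp.
   Context: Let $\mathcal{U}=\{z\in\mathbb{C}:|z|<1\}$. Let $\mathcal{S}$ denote the class of functions $f$ analytic and univalent in $\mathcal{U}$ normalized by $f(0)=0$, $f'(0)=1$, i.e. $f(z)=z+\sum_{n\ge2}a_nz^n$. For analytic $g,h$ on $\mathcal{U}$, $g\prec h$ ($g$ is subordinate to $h$) means there is an analytic $w$ on $\mathcal{U}$ with $w(0)=0$, $|w(z)|<1$, and $g(z)=h(w(z))$ for $z\in\mathcal{U}$. Let $\Psi(z)=\frac{z}{\ln(1+z)}$ on $\mathcal{U}$ (principal branch of the logarithm, $\Psi(0)=1$); it is the generating function $\sum_{n\ge0}G_nz^n$ of the Gregory coefficients $G_n$. Define $\mathcal{S}_G^{\ast}=\{f\in\mathcal{S}: zf'(z)/f(z)\prec\Psi(z)\}$. ''Sharp'' means the bound is attained by some function in $\mathcal{S}_G^{\ast}$. *)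

(* Defs.v *)
From Stdlib Require Import Reals.
From Coquelicot Require Import Coquelicot.
Open Scope R_scope.

Definition in_disk (z : C) : Prop := Cmod z < 1.

Definition analytic_disk (f : C -> C) : Prop :=
  forall z : C, in_disk z -> ex_derive (K := C_AbsRing) (V := C_NormedModule) f z.

Definition univalent_disk (f : C -> C) : Prop :=
  analytic_disk f /\
  forall z w : C, in_disk z -> in_disk w -> f z = f w -> z = w.

Definition class_S (f : C -> C) : Prop :=
  univalent_disk f /\ f (RtoC 0) = RtoC 0 /\
  is_derive (K := C_AbsRing) (V := C_NormedModule) f (RtoC 0) (RtoC 1).

Definition subordinate (g h : C -> C) : Prop :=
  exists w : C -> C, analytic_disk w /\ w (RtoC 0) = RtoC 0 /\
    (forall z, in_disk z -> Cmod (w z) < 1) /\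
    (forall z, in_disk z -> g z = h (w z)).

Definition Arg (u : C) : R :=
  let x := Re u in let y := Im u in
  if Rlt_dec 0 x then atan (y / x)
  else if Rlt_dec x 0 then
         (if Rle_dec 0 y then atan (y / x) + PI else atan (y / x) - PI)
  else if Rlt_dec 0 y then PI / 2
  else if Rlt_dec y 0 then - (PI / 2) else 0.

Definition Clog (u : C) : C := (ln (Cmod u), Arg u).

(* Psi(z) = z / log(1+z), Psi(0) = 1 (removable singularity) *)
Definition Psi (z : C) : C :=
  if Req_EM_T (Re z) 0 then
    (if Req_EM_T (Im z) 0 then RtoC 1 else Cdiv z (Clog (Cplus (RtoC 1) z)))
  else Cdiv z (Clog (Cplus (RtoC 1) z)).

(* z f'(z)/f(z), with its removable-singularity value 1 at z = 0 *)
Definition zfd_over_f (f fd : C -> C) (z : C) : C :=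
  if Req_EM_T (Re z) 0 then
    (if Req_EM_T (Im z) 0 then RtoC 1 else Cdiv (Cmult z (fd z)) (f z))
  else Cdiv (Cmult z (fd z)) (f z).

Definition class_SG (f : C -> C) : Prop :=
  class_S f /\
  exists fd : C -> C,
    (forall z, in_disk z -> is_derive (K := C_AbsRing) (V := C_NormedModule) f z (fd z)) /\
    subordinate (zfd_over_f f fd) Psi.

Definition coeffs_of (f : C -> C) (a : nat -> C) : Prop :=
  forall z : C, in_disk z -> is_pseries a z (f z).

(* Main.v *)
Require Import Defs.
From Stdlib Require Import Reals.
From Coquelicot Require Import Coquelicot.
From Stdlib Require Import Lra Lia Psatz.
Open Scope R_scope.

(** Write [z f'(z) / f(z) = G(w(z))] with [G] the power series of [Psi] and [w]
    a Schwarz function with Taylor coefficients [c_1, c_2, ...].  Comparing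
    coefficients expresses [2 (n - 1) a_n] as [c_(n-1)] plus a polynomial with
    small coefficients in [c_1, ..., c_(n-2)]; Bessel's inequality
    [sum |c_k|^2 <= 1] then already suffices for every bound.

    Bessel's inequality needs Cauchy's theorem for [w], which follows from
    differentiating circle means in the coordinate [log z] once [w'] is
    continuous; and [w'] is continuous because [G' <> 0] on the disk and [f] is
    a power series.

    For sharpness take [w(z) = z^(n-1)].  Kaluza's theorem on the reciprocal of
    [log(1+z)/z] gives [|G - 1| < 1], so the solution [f] of
    [z f' / f = G(z^(n-1))] is starlike, hence univalent. *)

(** * Complex derivatives *)

(** Bessel's inequality suffices because it couples the coefficients. It gives |c_(n-1)| <= 1 - s/2,
    where s is the sum of |c_k|^2 over k < n-1. All other monomials have degree at least two in
    these earlier c_k, so the triangle inequality, 2xy <= x^2 + y^2 and |c_k| <= 1 bound their total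
    by s/2. For n = 6 the constant is generous enough that |c_k| <= 1 does everything.

    The obstacle is w: analyticity provides a derivative at each point and nothing more, whereas f
    comes with a power series. Taylor coefficients of w are therefore those of an asymptotic
    expansion at 0 ([jet]) of v(z) = w(z)/z, obtained by solving the relation with f order by order.
    In the code [c k] is the coefficient of z^k in v, hence c_(k+1) above. *)

Definition Cderiv (f : C -> C) (z l : C) : Prop :=
  forall eps : R, 0 < eps -> exists d : R, 0 < d /\
    forall h : C, Cmod h < d ->
      Cmod (f (z + h) - f z - l * h)%C <= eps * Cmod h.

(** The increment form lets later estimates be made on moduli instead of filters. In the converse
    direction the abstract limit point x has to be identified with z before the estimate applies. *)
Lemma Cderiv_iff (f : C -> C) (z l : C) :
  is_derive (K := C_AbsRing) (V := C_NormedModule) f z l <-> Cderiv f z l.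
Proof.
  split.
  - intros [_ H] eps Heps.
    destruct (H z (fun P HP => HP) (mkposreal eps Heps)) as [d Hd].
    exists d; split; [apply cond_pos|]; intros h Hh.
    assert (B : Cmod ((z + h) - z)%C < d)
      by (replace ((z + h) - z)%C with h by ring; exact Hh).
    specialize (Hd (z + h)%C B).
    change (Cmod (f (z + h) - f z - ((z + h) - z) * l)%C
            <= eps * Cmod ((z + h) - z)%C) in Hd.
    replace ((z + h) - z)%C with h in Hd by ring.
    rewrite (Cmult_comm l h). exact Hd.
  - intros H. split.
    + apply is_linear_scal_l.
    + intros x Hx.
      assert (Ex : z = x).
      { apply (is_filter_lim_locally_unique
                 (K := C_AbsRing) (V := AbsRing_NormedModule C_AbsRing) z x Hx). }
      subst x. intros eps.
      destruct (H eps (cond_pos eps)) as [d [Hd Hh]].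
      assert (K : forall y : C, Cmod (y - z)%C < d ->
      Cmod (f y - f z - (y - z) * l)%C <= eps * Cmod (y - z)%C).
    { intros y Hy. specialize (Hh (y - z)%C Hy).
      replace (z + (y - z))%C with y in Hh by ring.
      rewrite (Cmult_comm (y - z) l). exact Hh. }
    exists (mkposreal d Hd). exact K.
Qed.

Lemma Cmod_triangle_minus (x y : C) : Cmod (x - y) <= Cmod x + Cmod y.
Proof.
  unfold Cminus. rewrite <- (Cmod_opp y). apply Cmod_triangle.
Qed.

Lemma Cderiv_unique (f : C -> C) (z l l' : C) :
  Cderiv f z l -> Cderiv f z l' -> l = l'.
Proof.
  intros H H'. apply Ceq_minus, Cmod_eq_0.
  destruct (Rle_lt_or_eq_dec 0 _ (Cmod_ge_0 (l - l')%C)) as [P|P]; [|auto].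
  exfalso.
  set (e := Cmod (l - l')%C) in *.
  assert (He : 0 < e / 4) by lra.
  destruct (H _ He) as [d [Hd K]], (H' _ He) as [d' [Hd' K']].
  set (t := Rmin d d' / 2).
  assert (Ht : 0 < t < d /\ t < d').
  { unfold t. pose proof (Rmin_l d d'). pose proof (Rmin_r d d').
    assert (0 < Rmin d d') by (apply Rmin_glb_lt; auto). lra. }
  assert (Et : Cmod (RtoC t) = t) by (rewrite Cmod_R; apply Rabs_pos_eq; lra).
  specialize (K (RtoC t)). specialize (K' (RtoC t)). rewrite Et in K, K'.
  assert (Q : Cmod ((l - l') * RtoC t)%C <= e / 4 * t + e / 4 * t).
  { replace ((l - l') * RtoC t)%C with
      ((f (z + RtoC t) - f z - l' * RtoC t) - (f (z + RtoC t) - f z - l * RtoC t))%C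
      by ring.
    eapply Rle_trans; [apply Cmod_triangle_minus|].
    apply Rplus_le_compat; [apply K'|apply K]; lra. }
  rewrite Cmod_mult, Et in Q. fold e in Q. nra.
Qed.

Lemma Cderiv_lip (f : C -> C) (z l : C) :
  Cderiv f z l -> exists d, 0 < d /\ forall h, Cmod h < d ->
    Cmod (f (z + h) - f z)%C <= (Cmod l + 1) * Cmod h.
Proof.
  intros H. destruct (H 1 Rlt_0_1) as [d [Hd K]]. exists d; split; auto.
  intros h Hh. specialize (K h Hh).
  replace (f (z + h) - f z)%C with ((f (z + h) - f z - l * h) + l * h)%C by ring.
  eapply Rle_trans; [apply Cmod_triangle|]. rewrite Cmod_mult. lra.
Qed.

Lemma Cderiv_cont (f : C -> C) (z l : C) :
  Cderiv f z l -> forall eps, 0 < eps -> exists d, 0 < d /\ forall h, Cmod h < d ->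
    Cmod (f (z + h) - f z)%C < eps.
Proof.
  intros H eps He. destruct (Cderiv_lip _ _ _ H) as [d [Hd K]].
  pose proof (Cmod_ge_0 l) as Hl.
  exists (Rmin d (eps / (Cmod l + 1))). split.
  - apply Rmin_glb_lt; auto. apply Rdiv_lt_0_compat; lra.
  - intros h Hh.
    assert (h1 : Cmod h < d) by (eapply Rlt_le_trans; [exact Hh|apply Rmin_l]).
    assert (h2 : Cmod h < eps / (Cmod l + 1))
      by (eapply Rlt_le_trans; [exact Hh|apply Rmin_r]).
    eapply Rle_lt_trans; [apply K; auto|].
    apply Rlt_le_trans with ((Cmod l + 1) * (eps / (Cmod l + 1))).
    + apply Rmult_lt_compat_l; lra.
    + right. field. lra.
Qed.

Lemma Cderiv_ext_loc (f g : C -> C) (z l : C) (d : R) :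
  0 < d -> (forall h, Cmod h < d -> f (z + h)%C = g (z + h)%C) ->
  Cderiv f z l -> Cderiv g z l.
Proof.
  intros Hd E H eps He. destruct (H eps He) as [d' [Hd' K]].
  exists (Rmin d d'). split; [apply Rmin_glb_lt; auto|].
  intros h Hh.
  assert (h1 : Cmod h < d) by (eapply Rlt_le_trans; [exact Hh|apply Rmin_l]).
  assert (h2 : Cmod h < d') by (eapply Rlt_le_trans; [exact Hh|apply Rmin_r]).
  rewrite <- (E h h1).
  assert (Ez : f z = g z).
  { rewrite <- (Cplus_0_r z). apply E. rewrite Cmod_0. auto. }
  rewrite <- Ez. apply K; auto.
Qed.

Lemma Cderiv_const (c z : C) : Cderiv (fun _ => c) z 0.
Proof.
  intros eps He. exists 1; split; [lra|]. intros h _.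
  replace (c - c - 0 * h)%C with (RtoC 0) by ring. rewrite Cmod_0.
  apply Rmult_le_pos; [lra|apply Cmod_ge_0].
Qed.

Lemma Cderiv_id (z : C) : Cderiv (fun x => x) z 1.
Proof.
  intros eps He. exists 1; split; [lra|]. intros h _.
  replace (z + h - z - 1 * h)%C with (RtoC 0) by ring. rewrite Cmod_0.
  apply Rmult_le_pos; [lra|apply Cmod_ge_0].
Qed.

Lemma Cderiv_plus (f g : C -> C) (z l m : C) :
  Cderiv f z l -> Cderiv g z m -> Cderiv (fun x => f x + g x)%C z (l + m)%C.
Proof.
  intros H H' eps He. assert (He2 : 0 < eps / 2) by lra.
  destruct (H _ He2) as [d [Hd K]], (H' _ He2) as [d' [Hd' K']].
  exists (Rmin d d'). split; [apply Rmin_glb_lt; auto|].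
  intros h Hh.
  assert (h1 : Cmod h < d) by (eapply Rlt_le_trans; [exact Hh|apply Rmin_l]).
  assert (h2 : Cmod h < d') by (eapply Rlt_le_trans; [exact Hh|apply Rmin_r]).
  replace (f (z + h) + g (z + h) - (f z + g z) - (l + m) * h)%C with
    ((f (z + h) - f z - l * h) + (g (z + h) - g z - m * h))%C by ring.
  eapply Rle_trans; [apply Cmod_triangle|].
  specialize (K h h1). specialize (K' h h2). lra.
Qed.

Lemma Cderiv_comp (f g : C -> C) (z l m : C) :
  Cderiv f (g z) l -> Cderiv g z m -> Cderiv (fun x => f (g x)) z (l * m)%C.
Proof.
  intros Hf Hg eps He.
  pose proof (Cmod_ge_0 l) as Hl. pose proof (Cmod_ge_0 m) as Hm.
  set (e1 := eps / 2 / (Cmod m + 1)).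
  set (e2 := eps / 2 / (Cmod l + 1)).
  assert (He1 : 0 < e1) by (apply Rdiv_lt_0_compat; lra).
  assert (He2 : 0 < e2) by (apply Rdiv_lt_0_compat; lra).
  destruct (Hf _ He1) as [d1 [Hd1 K1]].
  destruct (Hg _ He2) as [d2 [Hd2 K2]].
  destruct (Cderiv_lip _ _ _ Hg) as [d3 [Hd3 K3]].
  destruct (Cderiv_cont _ _ _ Hg d1 Hd1) as [d4 [Hd4 K4]].
  exists (Rmin d2 (Rmin d3 d4)).
  split; [repeat apply Rmin_glb_lt; auto|].
  intros h Hh.
  assert (B := Rmin_l d2 (Rmin d3 d4)). assert (B' := Rmin_r d2 (Rmin d3 d4)).
  assert (B2 := Rmin_l d3 d4). assert (B3 := Rmin_r d3 d4).
  specialize (K2 h ltac:(lra)). specialize (K3 h ltac:(lra)).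
  specialize (K4 h ltac:(lra)).
  specialize (K1 _ K4).
  replace (g z + (g (z + h) - g z))%C with (g (z + h)%C) in K1 by ring.
  replace (f (g (z + h)) - f (g z) - l * m * h)%C with
    ((f (g (z + h)) - f (g z) - l * (g (z + h) - g z))
     + l * (g (z + h) - g z - m * h))%C by ring.
  eapply Rle_trans; [apply Cmod_triangle|].
  rewrite (Cmod_mult l).
  pose proof (Cmod_ge_0 h) as Hh0.
  assert (A1 : Cmod (f (g (z + h)) - f (g z) - l * (g (z + h) - g z))%C
               <= eps / 2 * Cmod h).
  { eapply Rle_trans; [exact K1|].
    apply Rle_trans with (e1 * ((Cmod m + 1) * Cmod h)).
    - apply Rmult_le_compat_l; lra.
    - right. unfold e1. field. lra. }
  assert (A2 : Cmod l * Cmod (g (z + h) - g z - m * h)%C <= eps / 2 * Cmod h).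
  { apply Rle_trans with ((Cmod l + 1) * (e2 * Cmod h)).
    - apply Rmult_le_compat; try lra. apply Cmod_ge_0.
    - right. unfold e2. field. lra. }
  lra.
Qed.

Lemma Cderiv_sqr (z : C) : Cderiv (fun x => x * x)%C z (2 * z)%C.
Proof.
  intros eps He. exists eps; split; auto. intros h Hh.
  replace ((z + h) * (z + h) - z * z - 2 * z * h)%C with (h * h)%C by ring.
  rewrite Cmod_mult. apply Rmult_le_compat_r; [apply Cmod_ge_0|lra].
Qed.

Lemma Cderiv_scal (c z : C) : Cderiv (fun x => c * x)%C z c.
Proof.
  intros eps He. exists 1; split; [lra|]. intros h _.
  replace (c * (z + h) - c * z - c * h)%C with (RtoC 0) by ring. rewrite Cmod_0.
  apply Rmult_le_pos; [lra|apply Cmod_ge_0].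
Qed.

Lemma Cderiv_eq (f : C -> C) (z l l' : C) : l = l' -> Cderiv f z l -> Cderiv f z l'.
Proof. intros ->; auto. Qed.

Lemma Cderiv_ext (f g : C -> C) (z l : C) :
  (forall x, f x = g x) -> Cderiv f z l -> Cderiv g z l.
Proof. intros E. apply (Cderiv_ext_loc f g z l 1); [lra|]. intros; apply E. Qed.

(* Polarization: f g = ((f+g)^2 - (f-g)^2) / 4. *)
Lemma Cderiv_mult (f g : C -> C) (z l m : C) :
  Cderiv f z l -> Cderiv g z m ->
  Cderiv (fun x => f x * g x)%C z (l * g z + f z * m)%C.
Proof.
  intros Hf Hg.
  assert (Hg' := Cderiv_comp _ _ _ _ _ (Cderiv_scal (-(1)) (g z)) Hg). cbv beta in Hg'.
  assert (S1 := Cderiv_comp (fun y => y * y)%C (fun x => f x + g x)%C z _ _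
                  (Cderiv_sqr _) (Cderiv_plus _ _ _ _ _ Hf Hg)).
  assert (S2 := Cderiv_comp (fun y => y * y)%C (fun x => f x + - (1) * g x)%C z _ _
                  (Cderiv_sqr _) (Cderiv_plus _ _ _ _ _ Hf Hg')).
  assert (S3 := Cderiv_comp (fun y => - (1) * y)%C _ z _ _ (Cderiv_scal (-(1)) _) S2).
  assert (S4 := Cderiv_plus _ _ _ _ _ S1 S3).
  assert (S5 := Cderiv_comp (fun y => / 4 * y)%C _ z _ _ (Cderiv_scal (/ 4) _) S4).
  cbv beta in S5.
  assert (N4 : RtoC 4 <> 0%C) by (intro E; apply RtoC_inj in E; lra).
  refine (Cderiv_eq _ _ _ _ _ (Cderiv_ext _ _ _ _ _ S5)).
  - field; exact N4.
  - intros x. field; exact N4.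
Qed.

Lemma Cderiv_inv (z : C) : z <> 0%C -> Cderiv (fun x => / x)%C z (- / (z * z))%C.
Proof.
  intros Hz eps He.
  assert (Pz : 0 < Cmod z) by (apply Cmod_gt_0; auto).
  set (r := Cmod z) in *.
  (* The remainder is h^2 / (z^2 (z+h)). The first bound keeps |z+h| >= r/2, and the second then
     gives |h| <= eps r^2 |z+h|. *)
  exists (Rmin (r / 2) (eps * (r * r * r) / 2)). split.
  { apply Rmin_glb_lt; [lra|]. assert (0 < r * r * r) by (repeat apply Rmult_lt_0_compat; auto). nra. }
  intros h Hh.
  assert (B := Rmin_l (r / 2) (eps * (r * r * r) / 2)).
  assert (B' := Rmin_r (r / 2) (eps * (r * r * r) / 2)).
  assert (L : r / 2 <= Cmod (z + h)%C).
  { assert (T := Cmod_triangle (z + h)%C (- h)%C).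
    replace (z + h + - h)%C with z in T by ring. rewrite Cmod_opp in T. fold r in T. lra. }
  assert (Nzh : (z + h)%C <> 0%C) by (apply Cmod_gt_0; lra).
  replace (/ (z + h) - / z - - / (z * z) * h)%C with (h * h * / (z * z * (z + h)))%C.
  2:{ field. split; auto. }
  assert (Nd : (z * z * (z + h))%C <> 0%C) by (repeat apply Cmult_neq_0; auto).
  rewrite !Cmod_mult, Cmod_inv by auto. rewrite !Cmod_mult. fold r.
  pose proof (Cmod_ge_0 h).
  replace (Cmod h * Cmod h * / (r * r * Cmod (z + h)))
    with (Cmod h * / (r * r * Cmod (z + h)) * Cmod h) by ring.
  apply Rmult_le_compat_r; auto.
  apply Rmult_le_reg_r with (r * r * Cmod (z + h)%C).
  { repeat apply Rmult_lt_0_compat; lra. }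
  rewrite Rmult_assoc, Rinv_l, Rmult_1_r.
  2:{ apply Rgt_not_eq. repeat apply Rmult_lt_0_compat; lra. }
  apply Rle_trans with (eps * (r * r * r) / 2); [lra|].
  assert (0 < r * r) by nra. 
  replace (eps * (r * r * r) / 2) with (eps * (r * r * (r / 2))) by field.
  apply Rmult_le_compat_l; [lra|]. apply Rmult_le_compat_l; lra.
Qed.

Lemma Cderiv_div (f g : C -> C) (z l m : C) :
  g z <> 0%C -> Cderiv f z l -> Cderiv g z m ->
  Cderiv (fun x => f x / g x)%C z ((l * g z - f z * m) / (g z * g z))%C.
Proof.
  intros N Hf Hg.
  assert (Hi := Cderiv_comp _ _ _ _ _ (Cderiv_inv _ N) Hg).
  eapply Cderiv_eq; [|eapply Cderiv_mult; [exact Hf|exact Hi]].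
  cbv beta. field. auto.
Qed.

(** The bridge to real calculus: constancy, mean value and integration arguments are all run on real
    parts along lines. Imaginary parts, or components in another direction, are reached by first
    multiplying f by a complex constant. *)
Lemma Cderiv_Re_path (f : C -> C) (p d l : C) (t : R) :
  Cderiv f (p + RtoC t * d)%C l ->
  is_derive (fun s : R => Re (f (p + RtoC s * d)%C)) t (Re (l * d)%C).
Proof.
  intros H. split; [apply is_linear_scal_l|].
  intros x Hx.
  assert (Ex : t = x) by (apply (is_filter_lim_locally_unique
                 (K := R_AbsRing) (V := R_NormedModule) t x Hx)).
  subst x. intros eps.
  pose proof (Cmod_ge_0 d) as Hd0.
  assert (He : 0 < eps / (Cmod d + 1))
    by (apply Rdiv_lt_0_compat; [apply cond_pos|lra]).
  destruct (H _ He) as [dd [Hdd K]].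
  assert (Hdd2 : 0 < dd / (Cmod d + 1)) by (apply Rdiv_lt_0_compat; lra).
  exists (mkposreal _ Hdd2). intros y Hy.
  change (Rabs (y - t) < dd / (Cmod d + 1)) in Hy.
  change (Rabs (Re (f (p + RtoC y * d)%C) - Re (f (p + RtoC t * d)%C)
     - (y - t) * Re (l * d)%C) <= eps * Rabs (y - t)).
  assert (Eh : Cmod (RtoC (y - t) * d)%C = Rabs (y - t) * Cmod d)
    by (rewrite Cmod_mult, Cmod_R; auto).
  assert (Hy0 := Rabs_pos (y - t)).
  specialize (K (RtoC (y - t) * d)%C).
  assert (Ed : dd / (Cmod d + 1) * (Cmod d + 1) = dd) by (field; lra).
  specialize (K ltac:(rewrite Eh; nra)).
  replace (p + RtoC t * d + RtoC (y - t) * d)%C with (p + RtoC y * d)%C in K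
    by (rewrite RtoC_minus; ring).
  replace (Re (f (p + RtoC y * d)%C) - Re (f (p + RtoC t * d)%C)
     - (y - t) * Re (l * d)%C) with
    (Re (f (p + RtoC y * d) - f (p + RtoC t * d) - l * (RtoC (y - t) * d))%C).
  2:{ unfold Cminus. rewrite !re_plus, !re_opp.
      replace (l * (RtoC (y - t) * d))%C with (RtoC (y - t) * (l * d))%C by ring.
      rewrite re_scal_l. reflexivity. }
  eapply Rle_trans; [apply re_le_Cmod|].
  eapply Rle_trans; [exact K|]. rewrite Eh.
  assert (Ee : eps / (Cmod d + 1) * (Cmod d + 1) = eps) by (field; lra).
  assert (0 < eps) by apply cond_pos.
  apply Rle_trans with (eps / (Cmod d + 1) * (Cmod d + 1) * Rabs (y - t)).
  - rewrite Rmult_assoc. apply Rmult_le_compat_l; [lra|]. nra.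
  - rewrite Ee. lra.
Qed.

(** * Complex power series *)

Lemma sum_n_C (u : nat -> C) (n : nat) :
  sum_n (G := C_AbelianMonoid) u n
  = (sum_n (fun k => Re (u k)) n, sum_n (fun k => Im (u k)) n).
Proof.
  induction n as [|n IH].
  - rewrite !sum_O. unfold Re, Im. destruct (u 0%nat); reflexivity.
  - rewrite !sum_Sn, IH. unfold Re, Im. destruct (u (S n)); reflexivity.
Qed.

Lemma is_series_C (u : nat -> C) (l : C) :
  is_series (V := C_NormedModule) u l <->
  is_series (fun n => Re (u n)) (Re l) /\ is_series (fun n => Im (u n)) (Im l).
Proof.
  split.
  - intros H. split; apply filterlim_locally; intros eps;
      generalize (proj1 (filterlim_locally _ _) H eps); apply filter_imp;
      intros n [H1 H2]; rewrite sum_n_C in H1, H2; [exact H1|exact H2].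
  - intros [H1 H2]. apply filterlim_locally; intros eps.
    generalize (filter_and _ _ (proj1 (filterlim_locally _ _) H1 eps)
                               (proj1 (filterlim_locally _ _) H2 eps)).
    apply filter_imp. intros n [K1 K2].
    rewrite sum_n_C. split; [exact K1|exact K2].
Qed.

(** A total function built on the total [Series]; its value is meaningful only for convergent
    series. *)
Definition Csum (u : nat -> C) : C :=
  (Series (fun n => Re (u n)), Series (fun n => Im (u n))).

Definition abs_conv (u : nat -> C) : Prop := ex_series (fun n => Cmod (u n)).

Lemma Cmod_Ci : Cmod Ci = 1.
Proof.
  unfold Cmod, Ci; cbn [fst snd]. replace (0 ^ 2 + 1 ^ 2) with 1 by ring. apply sqrt_1.
Qed.

Lemma im_le_Cmod (c : C) : Rabs (Im c) <= Cmod c.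
Proof.
  rewrite <- (Cmod_conj c), <- Rabs_Ropp, <- im_conj, <- Rabs_Ropp, <- re_mult_Ci.
  eapply Rle_trans; [apply re_le_Cmod|]. rewrite Cmod_mult, Cmod_Ci. lra.
Qed.

Lemma abs_conv_re (u : nat -> C) : abs_conv u -> ex_series (fun n => Rabs (Re (u n))).
Proof.
  intros H. apply (@ex_series_le R_AbsRing R_CompleteNormedModule) with (2 := H).
  intros n. change (Rabs (Rabs (Re (u n))) <= Cmod (u n)).
  rewrite Rabs_Rabsolu. apply re_le_Cmod.
Qed.

Lemma abs_conv_im (u : nat -> C) : abs_conv u -> ex_series (fun n => Rabs (Im (u n))).
Proof.
  intros H. apply (@ex_series_le R_AbsRing R_CompleteNormedModule) with (2 := H).
  intros n. change (Rabs (Rabs (Im (u n))) <= Cmod (u n)).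
  rewrite Rabs_Rabsolu. apply im_le_Cmod.
Qed.

Lemma Csum_correct (u : nat -> C) :
  abs_conv u -> is_series (V := C_NormedModule) u (Csum u).
Proof.
  intros H. apply is_series_C. split; apply Series_correct, ex_series_Rabs.
  - apply abs_conv_re, H.
  - apply abs_conv_im, H.
Qed.

Lemma Csum_unique (u : nat -> C) (l : C) :
  is_series (V := C_NormedModule) u l -> Csum u = l.
Proof.
  intros H. apply is_series_C in H. destruct H as [H1 H2].
  unfold Csum. rewrite (is_series_unique _ _ H1), (is_series_unique _ _ H2).
  destruct l; reflexivity.
Qed.

Lemma Csum_ext (u v : nat -> C) : (forall n, u n = v n) -> Csum u = Csum v.
Proof.
  intros E. unfold Csum. f_equal; apply Series_ext; intros n; rewrite E; auto.
Qed.

Lemma abs_conv_plus (u v : nat -> C) :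
  abs_conv u -> abs_conv v -> abs_conv (fun n => u n + v n)%C.
Proof.
  intros Hu Hv. unfold abs_conv.
  apply (@ex_series_le R_AbsRing R_CompleteNormedModule)
    with (fun n => Cmod (u n) + Cmod (v n)).
  - intros n. change (Rabs (Cmod (u n + v n)%C) <= Cmod (u n) + Cmod (v n)).
    rewrite Rabs_pos_eq by apply Cmod_ge_0. apply Cmod_triangle.
  - apply (ex_series_plus (V := R_NormedModule)); auto.
Qed.

Lemma Csum_plus (u v : nat -> C) :
  abs_conv u -> abs_conv v -> Csum (fun n => u n + v n)%C = (Csum u + Csum v)%C.
Proof.
  intros Hu Hv. apply Csum_unique.
  apply (is_series_plus (V := C_NormedModule)); apply Csum_correct; auto.
Qed.

Lemma abs_conv_scal (c : C) (u : nat -> C) :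
  abs_conv u -> abs_conv (fun n => c * u n)%C.
Proof.
  intros Hu. unfold abs_conv.
  apply ex_series_ext with (fun n => scal (Cmod c) (Cmod (u n))).
  - intros n. rewrite Cmod_mult. reflexivity.
  - apply (ex_series_scal (V := R_NormedModule)); auto.
Qed.

Lemma Csum_scal (c : C) (u : nat -> C) :
  abs_conv u -> Csum (fun n => c * u n)%C = (c * Csum u)%C.
Proof.
  intros Hu. apply Csum_unique.
  apply (is_series_scal_l (V := C_NormedModule) c). apply Csum_correct; auto.
Qed.

Lemma Series_pos (u : nat -> R) :
  (forall n, 0 <= u n) -> ex_series u -> 0 <= Series u.
Proof.
  intros H Hu. rewrite <- (Rmult_0_l (Series u)), <- Series_scal_l.
  apply Series_le; auto. intros n. specialize (H n). lra.
Qed.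

(** Multiplying by the conjugate of the sum S makes |S|^2 the sum of a real series whose terms are
    at most |S| |u_n|, and |S| cancels. Bounding the two components separately would lose a constant
    factor. *)
Lemma Csum_norm (u : nat -> C) :
  abs_conv u -> Cmod (Csum u) <= Series (fun n => Cmod (u n)).
Proof.
  intros Hu. set (S := Csum u).
  assert (Hr : is_series (fun n => Re (Cconj S * u n)%C) (Re (Cconj S * S)%C)).
  { apply (proj1 (is_series_C (fun n => Cconj S * u n)%C (Cconj S * S)%C)).
    apply (is_series_scal_l (V := C_NormedModule)). apply Csum_correct; auto. }
  assert (E : Re (Cconj S * S)%C = Cmod S * Cmod S).
  { rewrite Cmult_comm, <- Cmod2_conj. simpl. ring. }
  assert (L : Cmod S * Cmod S <= Cmod S * Series (fun n => Cmod (u n))).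
  { rewrite <- E, <- (is_series_unique _ _ Hr), <- Series_scal_l.
    apply Rle_trans with (Series (fun n => Rabs (Re (Cconj S * u n)%C))).
    - eapply Rle_trans; [apply Rle_abs|]. apply Series_Rabs.
      apply (abs_conv_re (fun n => Cconj S * u n)%C), abs_conv_scal, Hu.
    - apply Series_le.
      + intros n. split; [apply Rabs_pos|].
        eapply Rle_trans; [apply re_le_Cmod|]. rewrite Cmod_mult, Cmod_conj. lra.
      + apply (ex_series_scal (V := R_NormedModule)); auto. }
  destruct (Rle_lt_or_eq_dec _ _ (Cmod_ge_0 S)) as [P|P].
  - apply Rmult_le_reg_l with (Cmod S); auto.
  - rewrite <- P. apply Series_pos; auto. intros n; apply Cmod_ge_0.
Qed.

Lemma Csum_incr (u : nat -> C) :
  abs_conv u -> Csum u = (u 0%nat + Csum (fun n => u (S n)))%C.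
Proof.
  intros Hu. unfold Csum.
  rewrite (Series_incr_1 (fun n => Re (u n))) by apply ex_series_Rabs, abs_conv_re, Hu.
  rewrite (Series_incr_1 (fun n => Im (u n))) by apply ex_series_Rabs, abs_conv_im, Hu.
  destruct (u 0%nat) as [x y]; unfold Re, Im; simpl. reflexivity.
Qed.

Lemma abs_conv_incr (u : nat -> C) : abs_conv u <-> abs_conv (fun n => u (S n)).
Proof. apply (ex_series_incr_1 (V := R_NormedModule) (fun n => Cmod (u n))). Qed.

(* conv a b n = sum_{k <= n} a_k b_{n-k}. *)
Fixpoint conv (a b : nat -> C) (n : nat) : C :=
  match n with
  | O => a O * b O
  | S m => a O * b (S m) + conv (fun k => a (S k)) b m
  end%C.

(** Splits the Cauchy product into four real ones, to each of which the real product theorem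
    applies. *)
Lemma conv_sum (a b : nat -> C) (n : nat) :
  conv a b n = (sum_f_R0 (fun k => Re (a k) * Re (b (n - k)%nat)) n
               - sum_f_R0 (fun k => Im (a k) * Im (b (n - k)%nat)) n,
                sum_f_R0 (fun k => Re (a k) * Im (b (n - k)%nat)) n
               + sum_f_R0 (fun k => Im (a k) * Re (b (n - k)%nat)) n).
Proof.
  revert a; induction n as [|n IH]; intros a.
  - simpl. unfold Cmult, Re, Im. f_equal; ring.
  - rewrite !(decomp_sum _ (S n)) by lia. simpl pred.
    change (conv a b (S n)) with (a O * b (S n) + conv (fun k => a (S k)) b n)%C.
    rewrite IH. simpl Nat.sub. unfold Cplus, Cmult, Re, Im; simpl. f_equal; ring.
Qed.

Lemma Csum_mult (u v : nat -> C) :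
  abs_conv u -> abs_conv v -> Csum (conv u v) = (Csum u * Csum v)%C.
Proof.
  intros Hu Hv. apply Csum_unique, is_series_C.
  assert (Su := proj1 (is_series_C _ _) (Csum_correct u Hu)).
  assert (Sv := proj1 (is_series_C _ _) (Csum_correct v Hv)).
  destruct Su as [Su1 Su2], Sv as [Sv1 Sv2].
  assert (Au1 := abs_conv_re u Hu). assert (Au2 := abs_conv_im u Hu).
  assert (Av1 := abs_conv_re v Hv). assert (Av2 := abs_conv_im v Hv).
  split.
  - apply is_series_ext with (fun n =>
      minus (sum_f_R0 (fun k => Re (u k) * Re (v (n - k)%nat)) n)
            (sum_f_R0 (fun k => Im (u k) * Im (v (n - k)%nat)) n)).
    { intros n. rewrite conv_sum. reflexivity. }
    apply (is_series_minus (V := R_NormedModule)).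
    + exact (is_series_mult _ _ _ _ Su1 Sv1 Au1 Av1).
    + exact (is_series_mult _ _ _ _ Su2 Sv2 Au2 Av2).
  - apply is_series_ext with (fun n =>
      plus (sum_f_R0 (fun k => Re (u k) * Im (v (n - k)%nat)) n)
            (sum_f_R0 (fun k => Im (u k) * Re (v (n - k)%nat)) n)).
    { intros n. rewrite conv_sum. reflexivity. }
    apply (is_series_plus (V := R_NormedModule)).
    + exact (is_series_mult _ _ _ _ Su1 Sv2 Au1 Av2).
    + exact (is_series_mult _ _ _ _ Su2 Sv1 Au2 Av1).
Qed.

Lemma conv_ext (a a' b b' : nat -> C) :
  (forall n, a n = a' n) -> (forall n, b n = b' n) ->
  forall n, conv a b n = conv a' b' n.
Proof.
  intros Ha Hb n; revert a a' Ha; induction n as [|n IH]; intros a a' Ha; simpl.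
  - rewrite Ha, Hb; auto.
  - rewrite Ha, Hb. f_equal. apply IH. intros; apply Ha.
Qed.

Lemma conv_pow (a b : nat -> C) (z : C) (n : nat) :
  conv (fun k => a k * z ^ k)%C (fun k => b k * z ^ k)%C n = (conv a b n * z ^ n)%C.
Proof.
  revert a; induction n as [|n IH]; intros a.
  - simpl. ring.
  - assert (E : forall c b m, conv (fun k => z * c k)%C b m = (z * conv c b m)%C).
    { clear. intros c b m; revert c; induction m as [|m IH]; intros c; simpl.
      - ring.
      - rewrite IH. ring. }
    simpl. rewrite (conv_ext _ (fun k => z * (a (S k) * z ^ k))%C _
                      (fun k => b k * z ^ k)%C); [|intros; simpl; ring|auto].
    rewrite E, IH. simpl. ring.
Qed.

(** * Power series with radius of convergence at least 1 *)

Definition cvdisk (a : nat -> C) : Prop :=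
  forall r, 0 < r < 1 -> ex_series (fun n => Cmod (a n) * r ^ n).

Definition PS (a : nat -> C) (z : C) : C := Csum (fun n => a n * z ^ n)%C.

Lemma cvdisk_abs (a : nat -> C) (z : C) :
  cvdisk a -> in_disk z -> abs_conv (fun n => a n * z ^ n)%C.
Proof.
  intros Ha Hz. unfold in_disk in Hz. pose proof (Cmod_ge_0 z) as Hz0.
  set (r := (Cmod z + 1) / 2).
  apply (@ex_series_le R_AbsRing R_CompleteNormedModule)
    with (fun n => Cmod (a n) * r ^ n); [|apply Ha; unfold r; lra].
  intros n. change (Rabs (Cmod (a n * z ^ n)%C) <= Cmod (a n) * r ^ n).
  rewrite Rabs_pos_eq by apply Cmod_ge_0. rewrite Cmod_mult, Cmod_pow.
  apply Rmult_le_compat_l; [apply Cmod_ge_0|]. apply pow_incr. unfold r; lra.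
Qed.

(** Abel's lemma: a bound on the terms at the midpoint s of r and 1 gives at r a geometric majorant
    of ratio r/s. *)
Lemma cvdisk_bounded (a : nat -> C) :
  (forall r, 0 < r < 1 -> exists M, forall n, Cmod (a n) * r ^ n <= M) -> cvdisk a.
Proof.
  intros H r Hr. set (s := (r + 1) / 2).
  destruct (H s ltac:(unfold s; lra)) as [M HM].
  apply (@ex_series_le R_AbsRing R_CompleteNormedModule)
    with (fun n => M * (r / s) ^ n).
  - intros n. change (Rabs (Cmod (a n) * r ^ n) <= M * (r / s) ^ n).
    rewrite Rabs_pos_eq.
    2:{ apply Rmult_le_pos; [apply Cmod_ge_0|apply pow_le; lra]. }
    replace r with (s * (r / s)) at 1 by (field; unfold s; lra).
    rewrite Rpow_mult_distr, <- Rmult_assoc.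
    apply Rmult_le_compat_r; [|apply HM].
    apply pow_le, Rlt_le, Rdiv_lt_0_compat; unfold s; lra.
  - apply (ex_series_scal (V := R_NormedModule) M (fun n => (r / s) ^ n)). apply ex_series_geom.
    rewrite Rabs_pos_eq.
    + apply Rmult_lt_reg_r with s; [unfold s; lra|].
      unfold Rdiv. rewrite Rmult_assoc, Rinv_l; unfold s; lra.
    + apply Rlt_le, Rdiv_lt_0_compat; unfold s; lra.
Qed.

Lemma cvdisk_le1 (a : nat -> C) : (forall n, Cmod (a n) <= 1) -> cvdisk a.
Proof.
  intros H. apply cvdisk_bounded. intros r Hr. exists 1. intros n.
  rewrite <- (Rmult_1_r 1). apply Rmult_le_compat; auto.
  - apply Cmod_ge_0.
  - apply pow_le; lra.
  - rewrite <- (pow1 n). apply pow_incr; lra.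
Qed.

Definition dps (a : nat -> C) (n : nat) : C := (RtoC (INR (S n)) * a (S n))%C.

(** With d = s/r - 1, Bernoulli's inequality gives (s/r)^n >= 1 + n d, and K = 1 + 1/d makes K (1 +
    n d) >= n + 1. *)
Lemma linear_le_geom (r s : R) : 0 < r < s ->
  exists K, 0 <= K /\ forall n, INR (S n) * r ^ n <= K * s ^ n.
Proof.
  intros H. set (d := s / r - 1).
  assert (Hd : 0 < d).
  { unfold d. apply Rlt_0_minus. apply Rmult_lt_reg_r with r; [lra|].
    unfold Rdiv. rewrite Rmult_assoc, Rinv_l; lra. }
  exists (1 + / d). split.
  { assert (0 < / d) by (apply Rinv_0_lt_compat; auto). lra. }
  intros n.
  replace s with (r * (1 + d)) by (unfold d; field; lra).
  rewrite Rpow_mult_distr.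
  assert (B : 1 + INR n * d <= (1 + d) ^ n) by (apply poly; auto).
  assert (L : INR (S n) <= (1 + / d) * (1 + d) ^ n).
  { apply Rle_trans with ((1 + / d) * (1 + INR n * d)).
    - rewrite S_INR. assert (0 < / d) by (apply Rinv_0_lt_compat; auto).
      assert (0 <= INR n) by apply pos_INR.
      replace ((1 + / d) * (1 + INR n * d)) with (1 + INR n + INR n * d + / d)
        by (field; lra). nra.
    - apply Rmult_le_compat_l; auto.
      assert (0 < / d) by (apply Rinv_0_lt_compat; auto). lra. }
  assert (0 < r ^ n) by (apply pow_lt; lra). nra.
Qed.

Lemma series_term_bounded (u : nat -> R) :
  ex_series u -> exists M, forall n, Rabs (u n) <= M.
Proof.
  intros H. apply ex_series_lim_0 in H.
  destruct (filterlim_bounded (V := R_NormedModule) u) as [M HM].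
  - exists 0. exact H.
  - exists M. exact HM.
Qed.

Lemma cvdisk_dps (a : nat -> C) : cvdisk a -> cvdisk (dps a).
Proof.
  intros Ha. apply cvdisk_bounded. intros r Hr.
  set (s := (r + 1) / 2).
  destruct (linear_le_geom r s ltac:(unfold s; lra)) as [K [HK L]].
  destruct (series_term_bounded _ (Ha s ltac:(unfold s; lra))) as [M HM].
  exists (K * (M / s)). intros n. unfold dps.
  rewrite Cmod_mult, Cmod_R, Rabs_pos_eq by apply pos_INR.
  specialize (L n). assert (HM' := Rle_trans _ _ _ (Rle_abs _) (HM (S n))). simpl pow in HM'.
  pose proof (Cmod_ge_0 (a (S n))).
  assert (Hs : 0 < s) by (unfold s; lra).
  apply Rle_trans with (K * (Cmod (a (S n)) * s ^ n)).
  - replace (INR (S n) * Cmod (a (S n)) * r ^ n)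
      with (Cmod (a (S n)) * (INR (S n) * r ^ n)) by ring.
    replace (K * (Cmod (a (S n)) * s ^ n)) with (Cmod (a (S n)) * (K * s ^ n)) by ring.
    apply Rmult_le_compat_l; auto.
  - apply Rmult_le_compat_l; auto.
    apply Rmult_le_reg_r with s; auto.
    replace (M / s * s) with M by (field; lra). lra.
Qed.

Lemma cvdisk_shift (a : nat -> C) : cvdisk a <-> cvdisk (fun n => a (S n)).
Proof.
  split; intros Ha r Hr; specialize (Ha r Hr).
  - apply (ex_series_incr_1 (V := R_NormedModule) (fun n => Cmod (a n) * r ^ n)) in Ha.
    apply (ex_series_scal (V := R_NormedModule) (/ r)) in Ha.
    eapply ex_series_ext; [|exact Ha]. intros n. cbv beta. simpl pow.
    change (/ r * (Cmod (a (S n)) * (r * r ^ n)) = Cmod (a (S n)) * r ^ n). field. lra.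
  - apply (ex_series_incr_1 (V := R_NormedModule) (fun n => Cmod (a n) * r ^ n)).
    apply (ex_series_scal (V := R_NormedModule) r) in Ha.
    eapply ex_series_ext; [|exact Ha]. intros n. cbv beta. simpl pow.
    change (r * (Cmod (a (S n)) * r ^ n) = Cmod (a (S n)) * (r * r ^ n)). ring.
Qed.

Lemma PS_incr (a : nat -> C) (z : C) : cvdisk a -> in_disk z ->
  PS a z = (a 0%nat + z * PS (fun n => a (S n)) z)%C.
Proof.
  intros Ha Hz. unfold PS. rewrite Csum_incr by (apply cvdisk_abs; auto).
  rewrite <- Csum_scal.
  - f_equal; [simpl; ring|]. apply Csum_ext. intros n. simpl. ring.
  - apply cvdisk_abs; auto. apply (proj1 (cvdisk_shift a)); auto.
Qed.

Lemma PS_mult (a b : nat -> C) (z : C) : cvdisk a -> cvdisk b -> in_disk z ->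
  PS (conv a b) z = (PS a z * PS b z)%C.
Proof.
  intros Ha Hb Hz. unfold PS. rewrite <- Csum_mult by (apply cvdisk_abs; auto).
  apply Csum_ext. intros n. symmetry. apply conv_pow.
Qed.

Lemma PS_ext (a b : nat -> C) (z : C) : (forall n, a n = b n) -> PS a z = PS b z.
Proof. intros E. apply Csum_ext. intros n; rewrite E; auto. Qed.

Lemma PS_0 (a : nat -> C) : cvdisk a -> PS a 0 = a 0%nat.
Proof.
  intros Ha. rewrite PS_incr; auto; [ring|]. unfold in_disk. rewrite Cmod_0; lra.
Qed.

(** The factor (n+1) n rho^(n-1) is twice the one of Taylor's formula, but it is exactly what
    differentiating a power series twice produces, so that summing over n gives a convergent
    majorant. *)
Lemma pow_taylor2 (z h : C) (rho : R) (n : nat) :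
  Cmod z <= rho -> Cmod (z + h)%C <= rho ->
  Cmod ((z + h) ^ (S n) - z ^ (S n) - RtoC (INR (S n)) * z ^ n * h)%C
  <= INR (S n) * INR n * rho ^ pred n * (Cmod h * Cmod h).
Proof.
  intros Hz Hzh. pose proof (Cmod_ge_0 z) as Hz0.
  induction n as [|n IH].
  - simpl. replace ((z + h) * 1 - z * 1 - 1 * 1 * h)%C with (RtoC 0) by ring.
    rewrite Cmod_0. lra.
  - replace ((z + h) ^ (S (S n)) - z ^ (S (S n)) - RtoC (INR (S (S n))) * z ^ (S n) * h)%C
      with ((z + h) * ((z + h) ^ (S n) - z ^ (S n) - RtoC (INR (S n)) * z ^ n * h)
            + RtoC (INR (S n)) * z ^ n * (h * h))%C.
    2:{ rewrite (S_INR (S n)), RtoC_plus. rewrite !Cpow_S. ring. }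
    eapply Rle_trans; [apply Cmod_triangle|].
    rewrite !Cmod_mult, Cmod_pow, Cmod_R, Rabs_pos_eq by apply pos_INR.
    assert (P0 : 0 <= Cmod h * Cmod h) by (apply Rmult_le_pos; apply Cmod_ge_0).
    assert (A1 : Cmod (z + h)%C *
       Cmod ((z + h) ^ S n - z ^ S n - RtoC (INR (S n)) * z ^ n * h)%C
       <= INR (S n) * INR n * rho ^ n * (Cmod h * Cmod h)).
    { apply Rle_trans with (rho * (INR (S n) * INR n * rho ^ pred n * (Cmod h * Cmod h))).
      - apply Rmult_le_compat; auto; apply Cmod_ge_0.
      - right. destruct n as [|n].
        + simpl. ring.
        + simpl pred. simpl pow. ring. }
    assert (A2 : INR (S n) * Cmod z ^ n * (Cmod h * Cmod h)
        <= INR (S n) * rho ^ n * (Cmod h * Cmod h)).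
    { apply Rmult_le_compat_r; auto. apply Rmult_le_compat_l; [apply pos_INR|].
      apply pow_incr; auto. }
    simpl pred. rewrite (S_INR (S n)).
    assert (P1 : 0 <= INR (S n) * rho ^ n * (Cmod h * Cmod h)).
    { apply Rmult_le_pos; auto. apply Rmult_le_pos; [apply pos_INR|apply pow_le; lra]. }
    rewrite (S_INR n) in *. nra.
Qed.

(** Term by term the remainder is at most M |h|^2, where M sums the moduli of the terms of the
    second derived series at radius rho. The choice of rho, halfway from |z| to 1, leaves room for
    both z and z+h. *)
Lemma PS_deriv (a : nat -> C) (z : C) : cvdisk a -> in_disk z ->
  Cderiv (PS a) z (PS (dps a) z).
Proof.
  intros Ha Hz. unfold in_disk in Hz.
  pose proof (Cmod_ge_0 z) as Hz0.
  set (rho := (Cmod z + 1) / 2).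
  assert (Hr : 0 < rho < 1) by (unfold rho; lra).
  assert (Hd := cvdisk_dps a Ha). assert (Hdd := cvdisk_dps _ Hd).
  set (M := Series (fun n => Cmod (dps (dps a) n) * rho ^ n)).
  assert (HM : 0 <= M).
  { apply Series_pos.
    - intros n. apply Rmult_le_pos; [apply Cmod_ge_0|apply pow_le; lra].
    - apply Hdd; auto. }
  assert (Q : forall h, Cmod h < (1 - Cmod z) / 2 ->
     Cmod (PS a (z + h) - PS a z - PS (dps a) z * h)%C <= M * (Cmod h * Cmod h)).
  { intros h Hh.
    assert (Hzh : Cmod (z + h)%C <= rho).
    { eapply Rle_trans; [apply Cmod_triangle|]. unfold rho; lra. }
    assert (Dz : in_disk z) by auto.
    assert (Dzh : in_disk (z + h)%C) by (unfold in_disk; lra).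
    assert (Sh := proj1 (cvdisk_shift a) Ha).
    assert (C1 := proj1 (abs_conv_incr _) (cvdisk_abs a _ Ha Dzh)).
    assert (C2 := proj1 (abs_conv_incr _) (cvdisk_abs a _ Ha Dz)).
    assert (C3 := cvdisk_abs _ _ Hd Dz).
    replace (PS a (z + h) - PS a z - PS (dps a) z * h)%C with
      (Csum (fun n => a (S n) * ((z + h) ^ (S n) - z ^ (S n) - RtoC (INR (S n)) * z ^ n * h))%C).
    2:{ unfold PS. rewrite (Csum_incr (fun n => a n * (z + h) ^ n)%C) by (apply cvdisk_abs; auto).
        rewrite (Csum_incr (fun n => a n * z ^ n)%C) by (apply cvdisk_abs; auto).
        rewrite (Csum_ext _ (fun n => (a (S n) * (z + h) ^ (S n)
           + - (1) * (a (S n) * z ^ (S n))) + (- h) * (dps a n * z ^ n))%C).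
        2:{ intros n. unfold dps. ring. }
        rewrite Csum_plus, Csum_plus, !Csum_scal; auto.
        - simpl. ring.
        - apply abs_conv_scal; auto.
        - apply abs_conv_plus; auto. apply abs_conv_scal; auto.
        - apply abs_conv_scal; auto. }
    set (v := fun n => (a (S n) * ((z + h) ^ (S n) - z ^ (S n) - RtoC (INR (S n)) * z ^ n * h))%C).
    assert (Hv0 : v 0%nat = 0%C) by (unfold v; simpl; ring).
    assert (Bd : forall n, Cmod (v (S n)) <=
        (Cmod h * Cmod h) * (Cmod (dps (dps a) n) * rho ^ n)).
    { intros n. unfold v. rewrite Cmod_mult.
      apply Rle_trans with (Cmod (a (S (S n))) *
        (INR (S (S n)) * INR (S n) * rho ^ n * (Cmod h * Cmod h))).
      - apply Rmult_le_compat_l; [apply Cmod_ge_0|].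
        apply (pow_taylor2 z h rho (S n)); auto. unfold rho; lra.
      - unfold dps. rewrite !Cmod_mult, !Cmod_R, !Rabs_pos_eq by apply pos_INR.
        right; ring. }
    assert (Ev : ex_series (fun n => (Cmod h * Cmod h) * (Cmod (dps (dps a) n) * rho ^ n))).
    { apply (ex_series_scal (V := R_NormedModule)). apply Hdd; auto. }
    assert (Av : abs_conv v).
    { apply abs_conv_incr.
      apply (@ex_series_le R_AbsRing R_CompleteNormedModule) with (2 := Ev).
      intros n. change (Rabs (Cmod (v (S n))) <=
        (Cmod h * Cmod h) * (Cmod (dps (dps a) n) * rho ^ n)).
      rewrite Rabs_pos_eq by apply Cmod_ge_0. apply Bd. }
    rewrite (Csum_incr v Av), Hv0, Cplus_0_l.
    eapply Rle_trans; [apply Csum_norm, (proj1 (abs_conv_incr v)), Av|].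
    unfold M. rewrite Rmult_comm, <- Series_scal_l.
    apply Series_le; [|exact Ev]. intros n; split; [apply Cmod_ge_0|apply Bd]. }
  intros eps He.
  exists (Rmin ((1 - Cmod z) / 2) (eps / (M + 1))). split.
  { apply Rmin_glb_lt; [lra|]. apply Rdiv_lt_0_compat; lra. }
  intros h Hh.
  assert (B := Rmin_l ((1 - Cmod z) / 2) (eps / (M + 1))).
  assert (B' := Rmin_r ((1 - Cmod z) / 2) (eps / (M + 1))).
  eapply Rle_trans; [apply Q; lra|].
  pose proof (Cmod_ge_0 h).
  rewrite <- Rmult_assoc. apply Rmult_le_compat_r; auto.
  assert (E : eps / (M + 1) * (M + 1) = eps) by (field; lra). nra.
Qed.

Lemma pow_n_C (z : C) (n : nat) : pow_n (K := C_Ring) z n = (z ^ n)%C.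
Proof. induction n as [|n IH]; [reflexivity|]. simpl. rewrite IH. reflexivity. Qed.

Lemma is_pseries_PS (a : nat -> C) (z : C) : cvdisk a -> in_disk z ->
  is_pseries (K := C_AbsRing) (V := C_NormedModule) a z (PS a z).
Proof.
  intros Ha Hz. unfold is_pseries.
  apply is_series_ext with (fun n => a n * z ^ n)%C.
  - intros n. change (a n * z ^ n = pow_n (K := C_Ring) z n * a n)%C.
    rewrite (pow_n_C z n). apply Cmult_comm.
  - apply Csum_correct, cvdisk_abs; auto.
Qed.

(** Convergence at the real point r already bounds the terms a_n r^n, which is enough for absolute
    convergence inside. *)
Lemma pseries_cvdisk (f : C -> C) (a : nat -> C) :
  coeffs_of f a -> cvdisk a /\ forall z, in_disk z -> f z = PS a z.
Proof.
  intros H.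
  assert (H' : forall z, in_disk z -> is_series (V := C_NormedModule) (fun n => a n * z ^ n)%C (f z)).
  { intros z Hz. specialize (H z Hz). unfold is_pseries in H.
    eapply is_series_ext; [|exact H]. intros n.
    change (pow_n (K := C_Ring) z n * a n = a n * z ^ n)%C.
    rewrite (pow_n_C z n). apply Cmult_comm. }
  split.
  - apply cvdisk_bounded. intros r Hr.
    assert (Dr : in_disk (RtoC r)).
    { unfold in_disk. rewrite Cmod_R, Rabs_pos_eq; lra. }
    specialize (H' _ Dr). apply is_series_C in H'. destruct H' as [H1 H2].
    destruct (series_term_bounded _ (ex_intro _ _ H1)) as [M1 B1].
    destruct (series_term_bounded _ (ex_intro _ _ H2)) as [M2 B2].
    exists (sqrt 2 * (M1 + M2)). intros n.
    replace (Cmod (a n) * r ^ n) with (Cmod (a n * RtoC r ^ n)%C).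
    2:{ rewrite Cmod_mult, Cmod_pow, Cmod_R, Rabs_pos_eq; lra. }
    eapply Rle_trans; [apply Cmod_2Rmax|].
    apply Rmult_le_compat_l; [apply sqrt_pos|].
    specialize (B1 n). specialize (B2 n).
    assert (Q1 := Rabs_pos (Re (a n * RtoC r ^ n)%C)).
    assert (Q2 := Rabs_pos (Im (a n * RtoC r ^ n)%C)).
    apply Rmax_lub; unfold Re, Im in *; lra.
  - intros z Hz. symmetry. apply Csum_unique; auto.
Qed.

(** * The logarithm and the Gregory coefficients *)

(** Sums over k < n, so that the empty sum exists; [sum_n] includes its upper index. *)
Fixpoint rsum (f : nat -> R) (n : nat) : R :=
  match n with O => 0 | S m => rsum f m + f m end.

Lemma rsum_ext (f g : nat -> R) (n : nat) :
  (forall k, (k < n)%nat -> f k = g k) -> rsum f n = rsum g n.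
Proof.
  induction n as [|n IH]; intros H; simpl; auto.
  rewrite IH, H; auto.
Qed.

Lemma rsum_le (f g : nat -> R) (n : nat) :
  (forall k, (k < n)%nat -> f k <= g k) -> rsum f n <= rsum g n.
Proof.
  induction n as [|n IH]; intros H; simpl; [lra|].
  apply Rplus_le_compat; auto.
Qed.

Lemma rsum_scal (c : R) (f : nat -> R) (n : nat) :
  rsum (fun k => c * f k) n = c * rsum f n.
Proof. induction n as [|n IH]; simpl; [ring|]. rewrite IH; ring. Qed.

Lemma rsum_first (f : nat -> R) (n : nat) :
  rsum f (S n) = f 0%nat + rsum (fun k => f (S k)) n.
Proof.
  induction n as [|n IH]; [simpl; ring|].
  change (rsum f (S n) + f (S n) = f 0%nat + (rsum (fun k => f (S k)) n + f (S n))).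
  rewrite IH. ring.
Qed.

Lemma rsum_sum_n (f : nat -> R) (n : nat) : sum_n f n = rsum f (S n).
Proof.
  induction n as [|n IH]; [rewrite sum_O; simpl; ring|].
  rewrite sum_Sn, IH. reflexivity.
Qed.

Lemma PS_bound (a : nat -> C) (z : C) (K : R) :
  cvdisk a -> in_disk z -> (forall n, rsum (fun k => Cmod (a k)) n <= K) ->
  Cmod (PS a z) <= K.
Proof.
  intros Ha Hz H.
  assert (Ab := cvdisk_abs a z Ha Hz).
  eapply Rle_trans; [apply Csum_norm, Ab|].
  assert (L := Series_correct _ Ab).
  change (is_lim_seq (sum_n (fun n => Cmod (a n * z ^ n)%C))
            (Series (fun n => Cmod (a n * z ^ n)%C))) in L.
  refine (is_lim_seq_le _ _ _ _ _ L (is_lim_seq_const K)).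
  intros n.
  rewrite rsum_sum_n. eapply Rle_trans; [|apply (H (S n))].
  apply rsum_le. intros k _. rewrite Cmod_mult, Cmod_pow.
  rewrite <- (Rmult_1_r (Cmod (a k))) at 2.
  apply Rmult_le_compat_l; [apply Cmod_ge_0|].
  rewrite <- (pow1 k). apply pow_incr. split; [apply Cmod_ge_0|].
  apply Rlt_le, Hz.
Qed.

Lemma PS_plus (a b : nat -> C) (z : C) : cvdisk a -> cvdisk b -> in_disk z ->
  PS (fun n => a n + b n)%C z = (PS a z + PS b z)%C.
Proof.
  intros Ha Hb Hz. unfold PS. rewrite <- Csum_plus by (apply cvdisk_abs; auto).
  apply Csum_ext. intros n; ring.
Qed.

Lemma PS_scal (c : C) (a : nat -> C) (z : C) : cvdisk a -> in_disk z ->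
  PS (fun n => c * a n)%C z = (c * PS a z)%C.
Proof.
  intros Ha Hz. unfold PS. rewrite <- Csum_scal by (apply cvdisk_abs; auto).
  apply Csum_ext. intros n; ring.
Qed.

Lemma cvdisk_plus (a b : nat -> C) : cvdisk a -> cvdisk b -> cvdisk (fun n => a n + b n)%C.
Proof.
  intros Ha Hb r Hr.
  apply (@ex_series_le R_AbsRing R_CompleteNormedModule)
    with (fun n => Cmod (a n) * r ^ n + Cmod (b n) * r ^ n).
  - intros n. change (Rabs (Cmod (a n + b n)%C * r ^ n) <= Cmod (a n) * r ^ n + Cmod (b n) * r ^ n).
    assert (0 <= r ^ n) by (apply pow_le; lra).
    rewrite Rabs_pos_eq by (apply Rmult_le_pos; auto; apply Cmod_ge_0).
    rewrite <- Rmult_plus_distr_r. apply Rmult_le_compat_r; auto. apply Cmod_triangle.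
  - apply (ex_series_plus (V := R_NormedModule)); auto.
Qed.

Definition scons (c : C) (a : nat -> C) (n : nat) : C :=
  match n with O => c | S m => a m end.

Lemma cvdisk_scons (c : C) (a : nat -> C) : cvdisk a -> cvdisk (scons c a).
Proof. intros H. apply (proj2 (cvdisk_shift (scons c a))). exact H. Qed.

Lemma PS_scons (c : C) (a : nat -> C) (z : C) : cvdisk a -> in_disk z ->
  PS (scons c a) z = (c + z * PS a z)%C.
Proof.
  intros Ha Hz. rewrite PS_incr; auto. apply cvdisk_scons, Ha.
Qed.

Lemma PS_zero (z : C) : PS (fun _ => 0%C) z = 0%C.
Proof.
  unfold PS. apply Csum_unique, is_series_C.
  assert (H : is_series (fun _ : nat => 0) 0).
  { apply filterlim_ext with (fun _ => 0).
    - intros n. symmetry. rewrite rsum_sum_n.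
      induction (S n) as [|m IH]; simpl; [auto|]. rewrite IH; ring.
    - apply filterlim_const. }
  split; (eapply is_series_ext; [|exact H]); intros n; simpl; ring.
Qed.

Lemma cvdisk_zero : cvdisk (fun _ => 0%C).
Proof. apply cvdisk_le1. intros; rewrite Cmod_0; lra. Qed.

Definition delta0 : nat -> C := scons 1 (fun _ => 0%C).

Lemma PS_delta0 (z : C) : in_disk z -> PS delta0 z = 1%C.
Proof.
  intros Hz. unfold delta0. rewrite PS_scons; auto using cvdisk_zero.
  rewrite PS_zero. ring.
Qed.

Lemma disk_1plus (z : C) : in_disk z -> 0 < 1 + Re z.
Proof.
  unfold in_disk. intros Hz. assert (H := re_le_Cmod z).
  apply Rabs_le_between in H. lra.
Qed.

Lemma disk_1plus_neq (z : C) : in_disk z -> (1 + z)%C <> 0%C.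
Proof.
  intros Hz E. apply disk_1plus in Hz.
  assert (E' : Re (1 + z)%C = 0) by (rewrite E; reflexivity).
  rewrite re_plus in E'. simpl in E'. lra.
Qed.

(* Coefficients of log(1+z)/z. *)
Definition logc (n : nat) : C := RtoC ((-1) ^ n * / INR (S n)).

Lemma pow_m1_abs (n : nat) : Rabs ((-1) ^ n) = 1.
Proof. rewrite <- RPow_abs, Rabs_m1. apply pow1. Qed.

Lemma inv_S_bounds (n : nat) : 0 < / INR (S n) <= 1.
Proof.
  assert (1 <= INR (S n)) by (rewrite S_INR; assert (H := pos_INR n); lra).
  split; [apply Rinv_0_lt_compat; lra|].
  rewrite <- Rinv_1. apply Rinv_le_contravar; lra.
Qed.

Lemma cvdisk_logc : cvdisk logc.
Proof.
  apply cvdisk_le1. intros n. unfold logc. rewrite Cmod_R, Rabs_mult, pow_m1_abs.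
  assert (H := inv_S_bounds n). rewrite Rabs_pos_eq; lra.
Qed.

(** The derived series E has coefficients (-1)^n; shifting them gives E = 1 - z E, hence E =
    1/(1+z). *)
Lemma Cderiv_log (z : C) : in_disk z -> Cderiv (fun u => u * PS logc u)%C z (/ (1 + z))%C.
Proof.
  intros Hz.
  set (e := fun n : nat => RtoC ((-1) ^ n)).
  assert (He : cvdisk e).
  { apply cvdisk_le1. intros n. unfold e. rewrite Cmod_R, pow_m1_abs. lra. }
  assert (Ee : (PS e z = 1 - z * PS e z)%C).
  { rewrite (PS_incr e z He Hz) at 1.
    rewrite (PS_ext (fun n => e (S n)) (fun n => - (1) * e n)%C).
    - rewrite PS_scal by auto. unfold e. simpl. ring.
    - intros n. unfold e. simpl. rewrite RtoC_mult. f_equal.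
      rewrite <- RtoC_opp. f_equal; lra. }
  assert (N := disk_1plus_neq z Hz).
  assert (Ei : PS e z = (/ (1 + z))%C).
  { assert (K : ((1 + z) * PS e z = 1)%C).
    { replace ((1 + z) * PS e z)%C with (PS e z + z * PS e z)%C by ring.
      rewrite Ee at 1. ring. }
    replace (PS e z) with ((1 + z) * PS e z * / (1 + z))%C by (field; exact N).
    rewrite K. ring. }
  rewrite <- Ei.
  assert (Hd := PS_deriv (scons 0 logc) z (cvdisk_scons 0 logc cvdisk_logc) Hz).
  rewrite (PS_ext _ e) in Hd.
  2:{ intros n. unfold dps, e, logc. cbn [scons]. rewrite <- RtoC_mult. f_equal.
      field. apply not_0_INR; lia. }
  unfold in_disk in Hz.
  apply (Cderiv_ext_loc (PS (scons 0 logc)) _ z _ (1 - Cmod z)); [lra| |exact Hd].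
  intros h Hh. rewrite PS_scons; [ring|exact cvdisk_logc|].
  unfold in_disk. eapply Rle_lt_trans; [apply Cmod_triangle|]. lra.
Qed.

Lemma is_derive_zero_eq (f : R -> R) :
  (forall t, 0 <= t <= 1 -> is_derive f t 0) -> f 1 = f 0.
Proof.
  intros H. symmetry. apply (eq_is_derive (V := R_NormedModule) f 0 1); [|lra].
  intros t Ht. apply H, Ht.
Qed.

Lemma scaled_disk (z : C) (t : R) : in_disk z -> 0 <= t <= 1 -> in_disk (RtoC t * z)%C.
Proof.
  unfold in_disk. intros Hz Ht. rewrite Cmod_mult, Cmod_R, Rabs_pos_eq by lra.
  pose proof (Cmod_ge_0 z). nra.
Qed.

Lemma im_as_re (z : C) : Im z = Re (- Ci * z)%C.
Proof. destruct z; unfold Re, Im, Ci, Copp, Cmult; simpl; ring. Qed.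

(** Since 1 + Re z > 0 on the disk, [Arg] is on its arctangent branch. Along the segment t z the
    real and imaginary parts of the series have the same derivatives as ln |1 + t z| and the
    arctangent, and everything vanishes at t = 0. *)
Lemma Clog_series (z : C) : in_disk z -> Clog (1 + z)%C = (z * PS logc z)%C.
Proof.
  intros Hz. set (x := Re z). set (y := Im z).
  assert (Ez : z = (x, y)) by (destruct z; reflexivity).
  set (L := fun u => (u * PS logc u)%C).
  assert (P : forall t, 0 <= t <= 1 -> 0 < 1 + t * x).
  { intros t Ht. assert (H := disk_1plus _ (scaled_disk z t Hz Ht)).
    rewrite re_scal_l in H. exact H. }
  assert (HL : forall t, 0 <= t <= 1 ->
     Cderiv L (0 + RtoC t * z)%C (/ (1 + RtoC t * z))%C).
  { intros t Ht. rewrite Cplus_0_l. apply Cderiv_log, scaled_disk; auto. }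
  assert (E1 : Re (L z) = ln (Cmod (1 + z)%C)).
  { set (phi := fun t => Re (L (0 + RtoC t * z)%C)
        - ln (sqrt ((1 + t * x) ^ 2 + (t * y) ^ 2))).
    assert (K : phi 1 = phi 0).
    { apply is_derive_zero_eq. intros t Ht. unfold phi.
      assert (D1 := Cderiv_Re_path _ _ _ _ _ (HL t Ht)). specialize (P t Ht).
      assert (Q : 0 < (1 + t * x) ^ 2 + (t * y) ^ 2) by nra.
      evar_last.
      - apply (is_derive_minus (V := R_NormedModule)); [exact D1|].
        auto_derive; [|reflexivity].
        replace ((1 + t * x) * ((1 + t * x) * 1) + t * y * (t * y * 1))
          with ((1 + t * x) ^ 2 + (t * y) ^ 2) by ring.
        repeat split; auto. apply sqrt_lt_R0; auto.
      - unfold minus, plus, opp; simpl.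
        replace ((1 + t * x) * ((1 + t * x) * 1) + t * y * (t * y * 1))
          with ((1 + t * x) ^ 2 + (t * y) ^ 2) by ring.
        set (Q' := (1 + t * x) ^ 2 + (t * y) ^ 2) in *.
        assert (Sq : sqrt Q' * sqrt Q' = Q') by (apply sqrt_sqrt; lra).
        assert (Sp : 0 < sqrt Q') by (apply sqrt_lt_R0; auto).
        rewrite (Rmult_assoc _ (/ (2 * sqrt Q')) (/ sqrt Q')).
        replace (/ (2 * sqrt Q') * / sqrt Q') with (/ (2 * (sqrt Q' * sqrt Q')))
          by (field; lra).
        rewrite Sq.
        rewrite Ez; unfold Cinv, Cmult, Cplus, Re, Im, RtoC; cbn [fst snd].
        unfold Q' in *. field. nra. }
    unfold phi in K.
    replace (0 + RtoC 1 * z)%C with z in K by ring.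
    replace (0 + RtoC 0 * z)%C with (RtoC 0) in K by ring.
    replace ((1 + 0 * x) ^ 2 + (0 * y) ^ 2) with 1 in K by ring.
    rewrite sqrt_1, ln_1 in K. unfold L in K at 2. rewrite Cmult_0_l in K. change (Re (RtoC 0)) with 0 in K.
    rewrite Ez at 2; unfold Cmod, Cplus, RtoC; cbn [fst snd].
    replace ((1 + x) ^ 2 + (0 + y) ^ 2) with ((1 + 1 * x) ^ 2 + (1 * y) ^ 2) by ring.
    lra. }
  assert (E2 : Im (L z) = atan (y / (1 + x))).
  { set (phi := fun t => Re (- Ci * L (0 + RtoC t * z))%C
        - atan (t * y / (1 + t * x))).
    assert (K : phi 1 = phi 0).
    { apply is_derive_zero_eq. intros t Ht. unfold phi.
      assert (D0 := Cderiv_comp (fun u => - Ci * u)%C L _ _ _ (Cderiv_scal _ _) (HL t Ht)).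
      assert (D1 := Cderiv_Re_path _ _ _ _ _ D0). specialize (P t Ht).
      evar_last.
      - apply (is_derive_minus (V := R_NormedModule)); [exact D1|].
        auto_derive; [|reflexivity]. lra.
      - unfold minus, plus, opp; simpl.
        rewrite Ez; unfold Ci, Copp, Cinv, Cmult, Cplus, Re, Im, RtoC, Rsqr; cbn [fst snd].
        field. repeat split; nra. }
    unfold phi in K.
    replace (0 + RtoC 1 * z)%C with z in K by ring.
    replace (0 + RtoC 0 * z)%C with (RtoC 0) in K by ring.
    replace (0 * y / (1 + 0 * x)) with 0 in K by field.
    rewrite atan_0 in K. unfold L in K at 2. rewrite Cmult_0_l, Cmult_0_r in K. change (Re (RtoC 0)) with 0 in K.
    rewrite <- im_as_re in K. rewrite !Rmult_1_l in K. lra. }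
  unfold Clog, Arg.
  change (Re (1 + z)%C) with (1 + x). change (Im (1 + z)%C) with (0 + y).
  specialize (P 1 ltac:(lra)). rewrite Rmult_1_l in P.
  destruct (Rlt_dec 0 (1 + x)) as [_|N]; [|lra].
  rewrite Rplus_0_l, <- E1, <- E2. change (z * PS logc z)%C with (L z).
  destruct (L z); reflexivity.
Qed.

(** Course-of-values recursion by tables: the n-th table holds the values at indices below n and the
    default d elsewhere. A step that reads only earlier indices never sees d, which is the
    hypothesis of [cov_rec_eq]. *)
Fixpoint rec_tab {T : Type} (F : (nat -> T) -> nat -> T) (d : T) (n : nat) : nat -> T :=
  match n with
  | O => fun _ => d
  | S m => fun k => if Nat.eqb k m then F (rec_tab F d m) m else rec_tab F d m k
  end.

Definition cov_rec {T : Type} (F : (nat -> T) -> nat -> T) (d : T) (n : nat) : T :=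
  F (rec_tab F d n) n.

Lemma cov_rec_eq {T : Type} (F : (nat -> T) -> nat -> T) (d : T) :
  (forall u v n, (forall k, (k < n)%nat -> u k = v k) -> F u n = F v n) ->
  forall n, cov_rec F d n = F (cov_rec F d) n.
Proof.
  intros H n. unfold cov_rec at 1. apply H.
  induction n as [|n IH]; intros k Hk; [lia|]. simpl.
  destruct (Nat.eqb_spec k n) as [->|N]; [reflexivity|]. apply IH; lia.
Qed.

(** [beta n] will be |G_(n+1)|. The recurrence is the vanishing of the coefficient of z^(n+1) in
    G(z) log(1+z)/z = 1, with the alternating signs taken out. *)
Definition beta : nat -> R :=
  cov_rec (fun u n => / INR (S (S n)) - rsum (fun k => u k * / INR (S (n - k))) n) 0.

Lemma beta_eq (n : nat) :
  beta n = / INR (S (S n)) - rsum (fun k => beta k * / INR (S (n - k))) n.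
Proof.
  unfold beta at 1. rewrite cov_rec_eq; [reflexivity|].
  intros u v m H. f_equal. apply rsum_ext. intros k Hk. rewrite H; auto.
Qed.

Lemma beta_rec (n : nat) :
  rsum (fun k => beta k * / INR (S (n - k))) (S n) = / INR (S (S n)).
Proof.
  cbn [rsum]. rewrite (beta_eq n), Nat.sub_diag. change (INR 1) with 1.
  field. apply not_0_INR; lia.
Qed.

(* Kaluza's argument, resting on the log-convexity of 1/(n+1). *)
Lemma beta_pos (n : nat) : 0 <= beta n.
Proof.
  induction n as [n IH] using (well_founded_induction Nat.lt_wf_0).
  destruct n as [|n].
  - rewrite beta_eq. simpl rsum. assert (H := inv_S_bounds 1). lra.
  - assert (P1 := inv_S_bounds (S n)). assert (P2 := inv_S_bounds (S (S n))).
    apply Rmult_le_reg_l with (/ INR (S (S n))); [lra|].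
    rewrite Rmult_0_r, (beta_eq (S n)), Rmult_minus_distr_l.
    apply -> Rminus_le_0.
    (* Expanding the factor 1/(n+2) on the right by the recurrence at n makes the claim termwise. It
       reduces to (n+3)(n+1-k) <= (n+2)(n+2-k), where the difference is k+1. *)
    rewrite <- (beta_rec n) at 2.
    rewrite (Rmult_comm (rsum _ _)), <- !rsum_scal.
    apply rsum_le. intros k Hk.
    assert (B := IH k Hk).
    replace (/ INR (S (S n)) * (beta k * / INR (S (S n - k))))
      with (beta k * (/ INR (S (S n)) * / INR (S (S n - k)))) by ring.
    replace (/ INR (S (S (S n))) * (beta k * / INR (S (n - k))))
      with (beta k * (/ INR (S (S (S n))) * / INR (S (n - k)))) by ring.
    apply Rmult_le_compat_l; auto.
    rewrite <- !Rinv_mult, <- !mult_INR.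
    apply Rinv_le_contravar; [apply lt_0_INR; nia|].
    apply le_INR. nia.
Qed.

(** In the recurrence each weight 1/(n-k+1) is at least 1/(n+2), which is the value of the weighted
    sum; nonnegativity of [beta] does the rest. *)
Lemma beta_sum_le1 (n : nat) : rsum beta n <= 1.
Proof.
  destruct n as [|n]; [simpl; lra|].
  assert (P := inv_S_bounds (S n)).
  apply Rmult_le_reg_l with (/ INR (S (S n))); [lra|].
  rewrite Rmult_1_r. rewrite <- (beta_rec n) at 2. rewrite <- rsum_scal.
  apply rsum_le. intros k Hk. rewrite Rmult_comm.
  apply Rmult_le_compat_l; [apply beta_pos|].
  apply Rinv_le_contravar; [apply lt_0_INR; lia|]. apply le_INR; lia.
Qed.

(* The Gregory coefficients. *)
Definition g : nat -> C := scons 1 (fun k => RtoC ((-1) ^ k * beta k)).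

Lemma g_abs (k : nat) : Cmod (g (S k)) = beta k.
Proof.
  simpl. rewrite Cmod_R, Rabs_mult, pow_m1_abs, Rabs_pos_eq by apply beta_pos. ring.
Qed.

Lemma beta_le1 (n : nat) : beta n <= 1.
Proof.
  assert (H := beta_sum_le1 (S n)). simpl in H.
  assert (0 <= rsum beta n).
  { clear H. induction n as [|n IH]; simpl; [lra|]. assert (B := beta_pos n). lra. }
  lra.
Qed.

Lemma g_le1 (n : nat) : Cmod (g n) <= 1.
Proof.
  destruct n as [|n].
  - simpl. rewrite Cmod_1. lra.
  - rewrite g_abs. apply beta_le1.
Qed.

Lemma cvdisk_g : cvdisk g.
Proof. apply cvdisk_le1, g_le1. Qed.

Lemma conv_alt (u v : nat -> R) (n : nat) :
  conv (fun k => RtoC ((-1) ^ k * u k)) (fun k => RtoC ((-1) ^ k * v k)) n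
  = RtoC ((-1) ^ n * rsum (fun k => u k * v (n - k)%nat) (S n)).
Proof.
  assert (Sc : forall a b m, conv (fun k => - (1) * a k)%C b m = (- (1) * conv a b m)%C).
  { intros a b m; revert a; induction m as [|m IH]; intros a; simpl; [ring|].
    rewrite IH; ring. }
  revert u; induction n as [|n IH]; intros u.
  - simpl. rewrite <- RtoC_mult. f_equal. ring.
  - change (RtoC ((-1) ^ 0 * u 0%nat) * RtoC ((-1) ^ S n * v (S n))
      + conv (fun k => RtoC ((-1) ^ S k * u (S k))) (fun k => RtoC ((-1) ^ k * v k)) n
      = RtoC ((-1) ^ S n * rsum (fun k => u k * v (S n - k)%nat)%R (S (S n))))%C.
    rewrite (conv_ext _ (fun k => - (1) * RtoC ((-1) ^ k * u (S k)))%C _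
               (fun k => RtoC ((-1) ^ k * v k))).
    + rewrite Sc, (IH (fun k => u (S k))), (rsum_first (fun k => u k * v (S n - k)%nat)%R).
      rewrite <- RtoC_opp, <- !RtoC_mult, <- RtoC_plus. f_equal.
      rewrite Nat.sub_0_r. simpl Nat.sub. simpl pow. ring.
    + intros k. rewrite <- RtoC_opp, <- RtoC_mult. f_equal. simpl. ring.
    + auto.
Qed.

Lemma conv_g_logc (n : nat) : conv g logc n = delta0 n.
Proof.
  destruct n as [|n].
  - simpl. unfold logc. rewrite <- RtoC_mult. simpl. f_equal. field.
  - change (1 * logc (S n) + conv (fun k => RtoC ((-1) ^ k * beta k))
              (fun k => RtoC ((-1) ^ k * / INR (S k))) n = 0)%C.
    rewrite (conv_alt beta (fun k => / INR (S k))), beta_rec. unfold logc.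
    rewrite Cmult_1_l, <- RtoC_plus. f_equal. simpl pow. ring.
Qed.

Lemma G_mul_logc (z : C) : in_disk z -> (PS g z * PS logc z = 1)%C.
Proof.
  intros Hz. rewrite <- PS_mult by auto using cvdisk_g, cvdisk_logc.
  rewrite (PS_ext _ _ z conv_g_logc). apply PS_delta0, Hz.
Qed.

Lemma G_near_1 (z : C) : in_disk z -> Cmod (PS g z - 1)%C < 1.
Proof.
  intros Hz. rewrite PS_incr by auto using cvdisk_g.
  change (g 0%nat) with (RtoC 1).
  replace (1 + z * PS (fun n => g (S n)) z - 1)%C with (z * PS (fun n => g (S n)) z)%C by ring.
  rewrite Cmod_mult.
  assert (B : Cmod (PS (fun n => g (S n)) z) <= 1).
  { apply PS_bound; auto.
    - apply (proj1 (cvdisk_shift g)), cvdisk_g.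
    - intros n. rewrite (rsum_ext _ beta); [apply beta_sum_le1|].
      intros k _. apply g_abs. }
  unfold in_disk in Hz. pose proof (Cmod_ge_0 z).
  pose proof (Cmod_ge_0 (PS (fun n => g (S n)) z)). nra.
Qed.

Lemma Psi_series (z : C) : in_disk z -> Psi z = PS g z.
Proof.
  intros Hz.
  assert (Q : z <> 0%C -> (z / Clog (1 + z) = PS g z)%C).
  { intros Nz. rewrite Clog_series by auto.
    assert (M := G_mul_logc z Hz).
    assert (N : PS logc z <> 0%C).
    { intros E. rewrite E, Cmult_0_r in M. symmetry in M. exact (C1_nz M). }
    rewrite <- (Cmult_1_l (z / _)%C), <- M. field. auto. }
  unfold Psi. destruct (Req_EM_T (Re z) 0) as [E1|N1].
  - destruct (Req_EM_T (Im z) 0) as [E2|N2].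
    + replace z with (RtoC 0) by (destruct z; unfold Re, Im, RtoC in *; simpl in *; congruence).
      rewrite PS_0; auto using cvdisk_g.
    + apply Q. intros E. apply N2. rewrite E; reflexivity.
  - apply Q. intros E. apply N1. rewrite E; reflexivity.
Qed.

(** With L(z) = log(1+z)/z, the series of -(1+z) L'(z) has coefficients (-1)^n / ((n+1)(n+2)). The
    first is 1/2, and the moduli of the others telescope to at most 1/2; as they carry a factor z
    with |z| < 1, they cannot cancel the first. *)
Lemma dlogc_neq_0 (z : C) : in_disk z -> PS (dps logc) z <> 0%C.
Proof.
  intros Hz E.
  assert (Hd := cvdisk_dps _ cvdisk_logc).
  set (m := fun n : nat => RtoC ((-1) ^ n * (/ INR (S n) * / INR (S (S n))))).
  assert (Am : forall n, Cmod (m n) = / INR (S n) * / INR (S (S n))).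
  { intros n. unfold m. assert (A := inv_S_bounds n). assert (B := inv_S_bounds (S n)).
    rewrite Cmod_R, Rabs_mult, pow_m1_abs, Rabs_pos_eq; nra. }
  assert (Hm : cvdisk m).
  { apply cvdisk_le1. intros n. rewrite Am.
    assert (A := inv_S_bounds n). assert (B := inv_S_bounds (S n)). nra. }
  assert (K : PS m z = 0%C).
  { rewrite <- (Cmult_0_r (- (1 + z))%C), <- E.
    replace (- (1 + z) * PS (dps logc) z)%C
      with (- (1) * (PS (dps logc) z + (0 + z * PS (dps logc) z)))%C by ring.
    rewrite <- (PS_scons 0), <- PS_plus, <- PS_scal; auto using cvdisk_scons, cvdisk_plus.
    apply PS_ext. intros n. unfold m, dps, logc. destruct n as [|n]; cbn [scons].
    - rewrite <- RtoC_opp, <- RtoC_mult, <- RtoC_plus, <- RtoC_mult. f_equal.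
      simpl. field.
    - rewrite <- RtoC_opp, <- !RtoC_mult, <- RtoC_plus, <- RtoC_mult. f_equal.
      simpl pow. rewrite !S_INR. assert (P := pos_INR n). field. lra. }
  rewrite PS_incr in K by auto.
  assert (B : Cmod (PS (fun n => m (S n)) z) <= / 2).
  { apply PS_bound; auto.
    - apply (proj1 (cvdisk_shift m)), Hm.
    - intros n.
      assert (T : rsum (fun k => Cmod (m (S k))) n = / 2 - / INR (S (S n))).
      { induction n as [|n IH].
        - simpl. lra.
        - change (rsum (fun k => Cmod (m (S k))) n + Cmod (m (S n)) = / 2 - / INR (S (S (S n)))).
          rewrite IH, Am, !S_INR. assert (P := pos_INR n). field. lra. }
      rewrite T. assert (P := inv_S_bounds (S n)). lra. }
  assert (K0 : m 0%nat = RtoC (/ 2)).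
  { unfold m. f_equal. simpl. field. }
  assert (K1 : RtoC (/ 2) = (- (z * PS (fun n => m (S n)) z))%C).
  { rewrite <- K0. apply Ceq_minus. rewrite <- K. ring. }
  assert (K2 : / 2 = Cmod z * Cmod (PS (fun n => m (S n)) z)).
  { rewrite <- Cmod_mult, <- Cmod_opp, <- K1, Cmod_R, Rabs_pos_eq; lra. }
  unfold in_disk in Hz. pose proof (Cmod_ge_0 z). nra.
Qed.

(** Differentiating G L = 1, where L(z) = log(1+z)/z, turns a zero of G' into a zero of L'. *)
Lemma dG_neq_0 (z : C) : in_disk z -> PS (dps g) z <> 0%C.
Proof.
  intros Hz E.
  assert (D := Cderiv_mult _ _ _ _ _ (PS_deriv g z cvdisk_g Hz) (PS_deriv logc z cvdisk_logc Hz)).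
  unfold in_disk in Hz.
  assert (D0 : Cderiv (fun _ => 1%C) z (PS (dps g) z * PS logc z + PS g z * PS (dps logc) z)%C).
  { apply (Cderiv_ext_loc _ _ z _ (1 - Cmod z)) with (3 := D); [lra|].
    intros h Hh. apply G_mul_logc. unfold in_disk.
    eapply Rle_lt_trans; [apply Cmod_triangle|]. lra. }
  assert (U := Cderiv_unique _ _ _ _ D0 (Cderiv_const 1 z)).
  rewrite E, Cmult_0_l, Cplus_0_l in U.
  assert (M := G_mul_logc z Hz).
  apply (dlogc_neq_0 z Hz).
  rewrite <- (Cmult_1_l (PS (dps logc) z)), <- M.
  replace (PS g z * PS logc z * PS (dps logc) z)%C with (PS logc z * (PS g z * PS (dps logc) z))%C by ring.
  rewrite U. ring.
Qed.

(** * The complex exponential and starlike functions *)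

Definition cexp (z : C) : C := (exp (Re z) * cos (Im z), exp (Re z) * sin (Im z)).

Lemma cexp_plus (a b : C) : cexp (a + b) = (cexp a * cexp b)%C.
Proof.
  unfold cexp. rewrite re_plus, im_plus, exp_plus, cos_plus, sin_plus.
  unfold Cmult; cbn [fst snd]. f_equal; ring.
Qed.

Lemma cexp_0 : cexp 0 = 1%C.
Proof. unfold cexp. simpl. rewrite exp_0, cos_0, sin_0. unfold RtoC. f_equal; ring. Qed.

Lemma Cmod_cexp (z : C) : Cmod (cexp z) = exp (Re z).
Proof.
  unfold cexp, Cmod; cbn [fst snd].
  assert (P := exp_pos (Re z)).
  replace ((exp (Re z) * cos (Im z)) ^ 2 + (exp (Re z) * sin (Im z)) ^ 2)
    with (exp (Re z) * exp (Re z) * (Rsqr (sin (Im z)) + Rsqr (cos (Im z))))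
    by (unfold Rsqr; ring).
  rewrite sin2_cos2, Rmult_1_r. apply sqrt_square. lra.
Qed.

Lemma cexp_neq_0 (z : C) : cexp z <> 0%C.
Proof. apply Cmod_gt_0. rewrite Cmod_cexp. apply exp_pos. Qed.

Lemma Cmod_le_sum (x y : R) : Cmod (x, y) <= Rabs x + Rabs y.
Proof.
  replace (x, y) with (RtoC x + Ci * RtoC y)%C.
  2:{ unfold RtoC, Ci, Cplus, Cmult; simpl. f_equal; ring. }
  eapply Rle_trans; [apply Cmod_triangle|]. rewrite Cmod_mult, !Cmod_R, Cmod_Ci. lra.
Qed.

Lemma derivable_lim_bound (f : R -> R) (l eps : R) :
  derivable_pt_lim f 0 l -> 0 < eps ->
  exists d, 0 < d /\ forall h, Rabs h < d -> Rabs (f h - f 0 - l * h) <= eps * Rabs h.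
Proof.
  intros H He. destruct (H eps He) as [d Hd]. exists d. split; [apply cond_pos|].
  intros h Hh. destruct (Req_dec h 0) as [->|N].
  - replace (f 0 - f 0 - l * 0) with 0 by ring. rewrite Rabs_R0. lra.
  - specialize (Hd h N Hh). rewrite Rplus_0_l in Hd.
    replace (f h - f 0 - l * h) with (((f h - f 0) / h - l) * h) by (field; auto).
    rewrite Rabs_mult. apply Rmult_le_compat_r; [apply Rabs_pos|]. lra.
Qed.

(** The derivative at 0 comes from those of the real exp, cos and sin; the functional equation
    carries it to z. *)
Lemma Cderiv_cexp (z : C) : Cderiv cexp z (cexp z).
Proof.
  assert (K0 : Cderiv cexp 0 1).
  { intros eps He.
    (* The two components of the remainder will be at most 4 e |h| and 5 e |h|. The condition e <= 1
       absorbs the products of the real remainders. *)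
    set (e := Rmin 1 (eps / 12)).
    assert (He0 : 0 < e) by (apply Rmin_glb_lt; lra).
    assert (He1 := Rmin_l 1 (eps / 12)). assert (He2 := Rmin_r 1 (eps / 12)). fold e in He1, He2. clearbody e.
    destruct (derivable_lim_bound _ _ e derivable_pt_lim_exp_0 He0) as [d1 [Hd1 K1]].
    destruct (derivable_lim_bound _ _ e derivable_pt_lim_cos_0 He0) as [d2 [Hd2 K2]].
    destruct (derivable_lim_bound _ _ e derivable_pt_lim_sin_0 He0) as [d3 [Hd3 K3]].
    exists (Rmin (Rmin d1 d2) (Rmin d3 e)).
    split; [repeat apply Rmin_glb_lt; auto|].
    intros h Hh.
    assert (B1 := Rmin_l (Rmin d1 d2) (Rmin d3 e)). assert (B2 := Rmin_r (Rmin d1 d2) (Rmin d3 e)).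
    assert (B3 := Rmin_l d1 d2). assert (B4 := Rmin_r d1 d2).
    assert (B5 := Rmin_l d3 e). assert (B6 := Rmin_r d3 e).
    rewrite Cplus_0_l, cexp_0.
    assert (X := re_le_Cmod h). assert (Y := im_le_Cmod h).
    specialize (K1 (Re h) ltac:(lra)). specialize (K2 (Im h) ltac:(lra)).
    specialize (K3 (Im h) ltac:(lra)).
    rewrite exp_0 in K1. rewrite cos_0 in K2. rewrite sin_0 in K3.
    replace (cexp h - 1 - 1 * h)%C with
      (exp (Re h) * cos (Im h) - 1 - Re h, exp (Re h) * sin (Im h) - Im h).
    2:{ destruct h; unfold cexp, Cminus, Cplus, Copp, Cmult, RtoC, Re, Im; simpl. f_equal; ring. }
    eapply Rle_trans; [apply Cmod_le_sum|].
    set (x := Re h) in *. set (y := Im h) in *. set (m := Cmod h) in *.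
    set (r1 := exp x - 1 - 1 * x) in *. set (r2 := cos y - 1 - 0 * y) in *.
    set (r3 := sin y - 0 - 1 * y) in *.
    replace (exp x * cos y - 1 - x) with (r1 + r2 + x * r2 + r1 * r2) by (unfold r1, r2; ring).
    replace (exp x * sin y - y) with (r3 + (x + r1) * (y + r3)) by (unfold r1, r3; ring).
    assert (X0 := Rabs_pos x). assert (Y0 := Rabs_pos y).
    assert (Q1 : Rabs r1 <= e * m) by nra. assert (Q2 : Rabs r2 <= e * m) by nra.
    assert (Q3 : Rabs r3 <= e * m) by nra.
    assert (M0 : 0 <= m) by apply Cmod_ge_0.
    assert (T : forall a b, Rabs (a + b) <= Rabs a + Rabs b) by apply Rabs_triang.
    assert (P1 := Rabs_pos r1). assert (P2 := Rabs_pos r2). assert (P3 := Rabs_pos r3).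
    assert (S1 : Rabs (r1 + r2 + x * r2 + r1 * r2) <= 4 * (e * m)).
    { eapply Rle_trans; [apply T|]. rewrite Rabs_mult.
      assert (T1 := T (r1 + r2) (x * r2)). rewrite Rabs_mult in T1. assert (T2 := T r1 r2).
      assert (Rabs x * Rabs r2 <= 1 * (e * m)) by (apply Rmult_le_compat; lra).
      assert (Rabs r1 * Rabs r2 <= 1 * (e * m)) by (apply Rmult_le_compat; nra).
      lra. }
    assert (S2 : Rabs (r3 + (x + r1) * (y + r3)) <= 5 * (e * m)).
    { eapply Rle_trans; [apply T|]. rewrite Rabs_mult.
      assert (T1 := T x r1). assert (T2 := T y r3).
      assert (Rabs (x + r1) * Rabs (y + r3) <= (2 * m) * (2 * e)).
      { apply Rmult_le_compat; try apply Rabs_pos; nra. }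
      lra. }
    nra. }
  apply (Cderiv_ext (fun w => cexp z * cexp (w + - z))%C).
  - intros w. rewrite <- cexp_plus. f_equal. ring.
  - assert (K1 : Cderiv cexp (z + - z) 1) by (rewrite Cplus_opp_r; exact K0).
    assert (K2 := Cderiv_comp cexp (fun w => w + - z)%C z _ _ K1
      (Cderiv_plus _ _ z _ _ (Cderiv_id z) (Cderiv_const (- z) z))).
    assert (K3 := Cderiv_comp (fun w => cexp z * w)%C _ z _ _ (Cderiv_scal _ _) K2).
    refine (Cderiv_eq _ _ _ _ _ K3). ring.
Qed.

(** Equal moduli give equal real parts. The difference of the imaginary parts has cosine 1, so the
    sine of its half vanishes. *)
Lemma cexp_eq (a b : C) : cexp a = cexp b ->
  exists k : Z, a = (b + RtoC (2 * PI * IZR k) * Ci)%C.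
Proof.
  intros E.
  assert (R1 : Re a = Re b).
  { apply exp_inv. rewrite <- !Cmod_cexp, E. reflexivity. }
  injection E as E1 E2. rewrite R1 in E1, E2. assert (P := exp_pos (Re b)).
  apply Rmult_eq_reg_l in E1; [|lra]. apply Rmult_eq_reg_l in E2; [|lra].
  assert (Cs : cos (2 * ((Im a - Im b) / 2)) = 1).
  { replace (2 * ((Im a - Im b) / 2)) with (Im a - Im b) by field.
    rewrite cos_minus, E1, E2. assert (H := sin2_cos2 (Im b)). unfold Rsqr in H. lra. }
  rewrite cos_2a_sin in Cs.
  assert (S0 : sin ((Im a - Im b) / 2) = 0) by nra.
  destruct (sin_eq_0_0 _ S0) as [k Hk]. exists k.
  destruct a as [a1 a2], b as [b1 b2]. unfold Re, Im in *; cbn [fst snd] in *.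
  unfold Cplus, Cmult, RtoC, Ci; cbn [fst snd]. f_equal; lra.
Qed.

Lemma cexp_2kpi (a : C) (k : Z) : cexp (a + RtoC (2 * PI * IZR k) * Ci) = cexp a.
Proof.
  rewrite cexp_plus.
  replace (cexp (RtoC (2 * PI * IZR k) * Ci)) with (RtoC 1); [ring|].
  unfold cexp. rewrite re_scal_l, im_scal_l. simpl (Re Ci). simpl (Im Ci).
  rewrite Rmult_0_r, exp_0, Rmult_1_r, !Rmult_1_l.
  assert (S0 : sin (PI * IZR k) = 0).
  { apply sin_eq_0_1. exists k. ring. }
  replace (2 * PI * IZR k) with (2 * (PI * IZR k)) by ring.
  rewrite cos_2a_sin, sin_2a, S0. unfold RtoC. f_equal; ring.
Qed.

Lemma cexp_surj (z : C) : z <> 0%C -> exists w, cexp w = z.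
Proof.
  intros Nz. assert (P : 0 < Cmod z) by (apply Cmod_gt_0; auto).
  assert (B := re_le_Cmod z). assert (S2 := Cmod2_alt z).
  set (r := Cmod z) in *.
  assert (Bt : -1 <= Re z / r <= 1).
  { apply Rabs_le_between in B.
    split; apply Rmult_le_reg_r with r; auto; unfold Rdiv; rewrite Rmult_assoc, Rinv_l; lra. }
  assert (Er : exp (ln r) = r) by (apply exp_ln; auto).
  assert (Ey : r * sqrt (1 - Rsqr (Re z / r)) = Rabs (Im z)).
  { rewrite <- (sqrt_square r) at 1 by lra.
    rewrite <- sqrt_mult_alt by nra.
    rewrite <- sqrt_Rsqr_abs. f_equal. unfold Rsqr.
    replace (r * r * (1 - Re z / r * (Re z / r))) with (r * r - Re z * Re z) by (field; lra).
    simpl in S2. nra. }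
  assert (Ex : r * (Re z / r) = Re z) by (field; lra).
  destruct (Rle_dec 0 (Im z)) as [Hy|Hy].
  - exists (ln r, acos (Re z / r)).
    change ((exp (ln r) * cos (acos (Re z / r)), exp (ln r) * sin (acos (Re z / r))) = z).
    rewrite Er, cos_acos, sin_acos, Ex, Ey by exact Bt.
    rewrite Rabs_pos_eq by auto. destruct z; reflexivity.
  - exists (ln r, - acos (Re z / r)).
    change ((exp (ln r) * cos (- acos (Re z / r)), exp (ln r) * sin (- acos (Re z / r))) = z).
    rewrite Er, cos_neg, sin_neg, cos_acos, sin_acos by exact Bt.
    rewrite <- Ropp_mult_distr_r, Ex, Ey.
    rewrite Rabs_left by lra. destruct z; unfold Re, Im; cbn. f_equal; ring.
Qed.

Lemma Cderiv_zero_const (F : C -> C) :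
  (forall z, in_disk z -> Cderiv F z 0) -> forall z, in_disk z -> F z = F 0%C.
Proof.
  intros H z Hz.
  assert (K : forall c : C, Re (c * F z)%C = Re (c * F 0%C)%C).
  { intros c.
    assert (E := is_derive_zero_eq (fun t => Re (c * F (0 + RtoC t * z))%C)).
    cbv beta in E.
    replace (0 + RtoC 1 * z)%C with z in E by ring.
    replace (0 + RtoC 0 * z)%C with (RtoC 0) in E by ring.
    apply E. intros t Ht.
    assert (Hd : in_disk (0 + RtoC t * z)%C)
      by (rewrite Cplus_0_l; apply scaled_disk; auto).
    assert (D := Cderiv_comp (fun u => c * u)%C F _ _ _ (Cderiv_scal c _) (H _ Hd)).
    assert (D' := Cderiv_Re_path _ _ _ _ _ D).
    replace (Re (c * 0 * z)%C) with 0 in D'; [exact D'|].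
    rewrite Cmult_0_r, Cmult_0_l. reflexivity. }
  assert (K1 := K 1%C). assert (K2 := K (- Ci)%C).
  rewrite !Cmult_1_l in K1. rewrite <- !im_as_re in K2.
  destruct (F z), (F 0%C); unfold Re, Im in *; simpl in *; congruence.
Qed.

Lemma conv_ext_le (a b b' : nat -> C) (n : nat) :
  (forall k, (k <= n)%nat -> b k = b' k) -> conv a b n = conv a b' n.
Proof.
  revert a; induction n as [|n IH]; intros a H; simpl.
  - rewrite H; auto.
  - rewrite H by auto. f_equal. apply IH. intros k Hk; apply H; lia.
Qed.

Lemma conv_bound (a b : nat -> C) (n : nat) :
  (forall k, Cmod (a k) <= 1) -> (forall k, (k <= n)%nat -> Cmod (b k) <= 1) ->
  Cmod (conv a b n) <= INR (S n).
Proof.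
  assert (P : forall x y, Cmod x <= 1 -> Cmod y <= 1 -> Cmod (x * y)%C <= 1).
  { intros x y Hx Hy. rewrite Cmod_mult.
    pose proof (Cmod_ge_0 x). pose proof (Cmod_ge_0 y). nra. }
  revert a; induction n as [|n IH]; intros a Ha Hb.
  - simpl. apply P; auto.
  - change (Cmod (a O * b (S n) + conv (fun k => a (S k)) b n)%C <= INR (S (S n))).
    eapply Rle_trans; [apply Cmod_triangle|]. rewrite (S_INR (S n)), Rplus_comm.
    apply Rplus_le_compat; [apply IH|apply P]; auto.
Qed.

(** * Solving z f'(z)/f(z) = q(z) when Re q > 0 *)

Section Starlike.

Variable q : nat -> C.
Hypothesis q_0 : q 0%nat = 1%C.
Hypothesis q_le1 : forall n, Cmod (q n) <= 1.
Hypothesis q_Re_pos : forall z, in_disk z -> 0 < Re (PS q z).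

(* Coefficients of f(z)/z, where z f'(z)/f(z) = q(z). *)
Definition star_coef : nat -> C :=
  cov_rec (fun (u : nat -> C) n => match n with
                      | O => 1%C
                      | S m => (RtoC (/ INR (S m)) * conv (fun k => q (S k)) u m)%C
                      end) 0%C.

Lemma star_coef_eq (n : nat) : star_coef n =
  match n with
  | O => 1%C
  | S m => (RtoC (/ INR (S m)) * conv (fun k => q (S k)) star_coef m)%C
  end.
Proof.
  unfold star_coef at 1. rewrite cov_rec_eq; [reflexivity|].
  intros u v [|m] H; auto. f_equal. apply conv_ext_le. intros k Hk; apply H; lia.
Qed.

(** The recurrence takes the average of m+1 products of coefficients, so the bound |q_k| <= 1
    propagates. *)
Lemma star_coef_le1 (n : nat) : Cmod (star_coef n) <= 1.
Proof.
  induction n as [n IH] using (well_founded_induction Nat.lt_wf_0).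
  rewrite star_coef_eq. destruct n as [|n].
  - rewrite Cmod_1; lra.
  - assert (P := inv_S_bounds n).
    rewrite Cmod_mult, Cmod_R, Rabs_pos_eq by lra.
    apply Rle_trans with (/ INR (S n) * INR (S n)).
    + apply Rmult_le_compat_l; [lra|]. apply conv_bound.
      * intros k; apply q_le1.
      * intros k Hk; apply IH; lia.
    + rewrite Rinv_l; [lra|]. apply not_0_INR; lia.
Qed.

(** The series H of log(f(z)/z), normalized by H(0) = 0 and determined by z H'(z) = q(z) - 1. *)
Definition log_star_coef : nat -> C := scons 0 (fun n => RtoC (/ INR (S n)) * q (S n))%C.

Let A := PS star_coef.
Let H := PS log_star_coef.

Lemma cvdisk_q : cvdisk q.
Proof. apply cvdisk_le1, q_le1. Qed.

Lemma cvdisk_star : cvdisk star_coef.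
Proof. apply cvdisk_le1, star_coef_le1. Qed.

Lemma cvdisk_log_star : cvdisk log_star_coef.
Proof.
  apply cvdisk_scons, cvdisk_le1. intros n.
  assert (P := inv_S_bounds n). assert (Q := q_le1 (S n)). assert (Q0 := Cmod_ge_0 (q (S n))).
  rewrite Cmod_mult, Cmod_R, Rabs_pos_eq by lra. nra.
Qed.

Lemma INR_S_inv_C (n : nat) (c : C) : (RtoC (INR (S n)) * (RtoC (/ INR (S n)) * c) = c)%C.
Proof.
  rewrite Cmult_assoc, <- RtoC_mult, Rinv_r; [ring|]. apply not_0_INR; lia.
Qed.

Lemma log_star_deriv (z : C) : in_disk z -> Cderiv H z (PS (fun n => q (S n)) z).
Proof.
  intros Hz. assert (D := PS_deriv _ z cvdisk_log_star Hz).
  rewrite (PS_ext _ (fun n => q (S n))) in D; [exact D|].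
  intros n. unfold dps. cbn [log_star_coef scons]. apply INR_S_inv_C.
Qed.

Lemma star_quot_deriv (z : C) : in_disk z -> Cderiv A z (PS (fun n => q (S n)) z * A z)%C.
Proof.
  intros Hz. assert (D := PS_deriv _ z cvdisk_star Hz).
  rewrite (PS_ext _ (conv (fun n => q (S n)) star_coef)) in D.
  - rewrite PS_mult in D; auto using cvdisk_star.
    apply (proj1 (cvdisk_shift q)), cvdisk_q.
  - intros n. unfold dps. rewrite star_coef_eq. apply INR_S_inv_C.
Qed.

(** From A' = H' A the product A e^(-H) has derivative 0, and it equals 1 at the origin. In
    particular A = f(z)/z has no zero. *)
Lemma star_quot_exp (z : C) : in_disk z -> A z = cexp (H z).
Proof.
  intros Hz.
  assert (E : (A z * cexp (- (1) * H z) = A 0 * cexp (- (1) * H 0))%C).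
  { apply (Cderiv_zero_const (fun z => A z * cexp (- (1) * H z))%C); auto.
    intros u Hu.
    assert (D1 := Cderiv_comp (fun x => - (1) * x)%C H u _ _ (Cderiv_scal _ _) (log_star_deriv u Hu)).
    assert (D2 := Cderiv_comp cexp _ u _ _ (Cderiv_cexp _) D1).
    assert (D3 := Cderiv_mult _ _ u _ _ (star_quot_deriv u Hu) D2).
    refine (Cderiv_eq _ _ _ _ _ D3). ring. }
  unfold A at 2 in E. unfold H at 2 in E.
  rewrite !PS_0 in E by auto using cvdisk_star, cvdisk_log_star.
  rewrite star_coef_eq in E. change (log_star_coef 0) with (RtoC 0) in E.
  rewrite Cmult_0_r, cexp_0, Cmult_1_l in E.
  replace (A z) with (A z * cexp (- (1) * H z) * cexp (H z))%C.
  - rewrite E. ring.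
  - rewrite <- Cmult_assoc, <- cexp_plus.
    replace (- (1) * H z + H z)%C with (RtoC 0) by ring. rewrite cexp_0. ring.
Qed.

Lemma q_split (z : C) : in_disk z -> PS q z = (1 + z * PS (fun n => q (S n)) z)%C.
Proof. intros Hz. rewrite PS_incr, q_0; auto using cvdisk_q. Qed.

Definition star_fun (z : C) : C := (z * A z)%C.

Lemma star_fun_deriv (z : C) : in_disk z -> Cderiv star_fun z (A z * PS q z)%C.
Proof.
  intros Hz.
  assert (D := Cderiv_mult _ _ z _ _ (Cderiv_id z) (star_quot_deriv z Hz)).
  refine (Cderiv_eq _ _ _ _ _ D). rewrite q_split by auto. ring.
Qed.

Lemma star_fun_coeffs : coeffs_of star_fun (scons 0 star_coef).
Proof.
  intros z Hz. replace (star_fun z) with (PS (scons 0 star_coef) z).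
  - apply is_pseries_PS; auto. apply cvdisk_scons, cvdisk_star.
  - rewrite PS_scons; auto using cvdisk_star. unfold star_fun, A. ring.
Qed.

(* In the coordinate zeta = log z the function log f becomes
   F(zeta) = zeta + H(e^zeta), and Re F' = Re q > 0 on a convex half plane. *)
Lemma star_fun_inj (z w : C) :
  in_disk z -> in_disk w -> star_fun z = star_fun w -> z = w.
Proof.
  intros Hz Hw E.
  assert (NA : forall u, in_disk u -> A u <> 0%C).
  { intros u Hu. rewrite star_quot_exp by auto. apply cexp_neq_0. }
  assert (Z0 : forall u v, in_disk u -> in_disk v -> star_fun u = star_fun v -> u = 0%C -> u = v).
  { intros u v Hu Hv Euv ->. unfold star_fun in Euv. rewrite Cmult_0_l in Euv.
    destruct (Ceq_dec v 0) as [Q|N]; [congruence|].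
    exfalso. apply (Cmult_neq_0 v (A v)); auto. }
  destruct (Ceq_dec z 0) as [Q|Nz]; [apply Z0; auto|].
  destruct (Ceq_dec w 0) as [Q|Nw]; [symmetry; apply Z0; auto|].
  destruct (cexp_surj z Nz) as [s Es]. destruct (cexp_surj w Nw) as [s' Es'].
  set (F := fun u => (u + H (cexp u))%C).
  assert (EF : cexp (F s) = cexp (F s')).
  { unfold F. rewrite !cexp_plus, Es, Es', <- !star_quot_exp by auto. exact E. }
  destruct (cexp_eq _ _ EF) as [k Hk].
  (* The ambiguity of the logarithm is absorbed into the choice of the preimage of w, so that F(s) =
     F(t) holds exactly. *)
  set (t := (s' + RtoC (2 * PI * IZR k) * Ci)%C).
  assert (Et : cexp t = w) by (unfold t; rewrite cexp_2kpi; exact Es').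
  assert (EF' : F s = F t).
  { rewrite Hk. unfold F. rewrite Et, Es'. unfold t. ring. }
  assert (Rs : Re s < 0).
  { apply exp_lt_inv. rewrite <- Cmod_cexp, Es, exp_0. exact Hz. }
  assert (Rt : Re t < 0).
  { apply exp_lt_inv. rewrite <- Cmod_cexp, Et, exp_0. exact Hw. }
  destruct (Ceq_dec s t) as [Q|Nst]; [rewrite <- Es, <- Et, Q; reflexivity|].
  exfalso. set (D := (s - t)%C).
  assert (PD : 0 < Cmod D) by (apply Cmod_gt_0, Cminus_eq_contra, Nst).
  assert (dF : forall x, 0 <= x <= 1 ->
    Cderiv F (t + RtoC x * D)%C (PS q (cexp (t + RtoC x * D))) /\
    in_disk (cexp (t + RtoC x * D))).
  { intros x Hx.
    assert (Hd : in_disk (cexp (t + RtoC x * D))).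
    { unfold in_disk. rewrite Cmod_cexp, <- exp_0. apply exp_increasing.
      rewrite re_plus, re_scal_l. unfold D, Cminus. rewrite re_plus, re_opp. nra. }
    split; auto.
    assert (D1 := Cderiv_comp H cexp _ _ _ (log_star_deriv _ Hd) (Cderiv_cexp _)).
    assert (D2 := Cderiv_plus _ _ _ _ _ (Cderiv_id _) D1).
    refine (Cderiv_eq _ _ _ _ _ D2). rewrite (q_split _ Hd). ring. }
  (* The conjugate of D makes the derivative |D|^2 Re q, which is positive, although phi takes the
     same value at 0 and 1. *)
  set (phi := fun x => Re (Cconj D * F (t + RtoC x * D))%C).
  assert (dphi : forall x, 0 <= x <= 1 -> is_derive phi x
     (Cmod D ^ 2 * Re (PS q (cexp (t + RtoC x * D))))).
  { intros x Hx. destruct (dF x Hx) as [D1 _].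
    assert (D2 := Cderiv_comp (fun u => Cconj D * u)%C F _ _ _ (Cderiv_scal _ _) D1).
    assert (D3 := Cderiv_Re_path _ _ _ _ _ D2).
    rewrite <- re_scal_l, Cmod2_conj.
    replace (D * Cconj D * PS q (cexp (t + RtoC x * D)))%C
      with (Cconj D * PS q (cexp (t + RtoC x * D)) * D)%C by ring.
    exact D3. }
  destruct (MVT_gen phi 0 1 (fun x => Cmod D ^ 2 * Re (PS q (cexp (t + RtoC x * D))))) as [c [Hc Ec]].
  - rewrite Rmin_left, Rmax_right by lra. intros x Hx. apply dphi; lra.
  - rewrite Rmin_left, Rmax_right by lra. intros x Hx.
    apply continuity_pt_filterlim, (ex_derive_continuous (V := R_NormedModule)).
    eexists; apply dphi; auto.
  - rewrite Rmin_left, Rmax_right in Hc by lra.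
    unfold phi in Ec.
    replace (t + RtoC 1 * D)%C with s in Ec by (unfold D; ring).
    replace (t + RtoC 0 * D)%C with t in Ec by ring.
    rewrite EF', Rminus_diag in Ec.
    assert (Pq := q_Re_pos _ (proj2 (dF c Hc))).
    assert (0 < Cmod D ^ 2) by (apply pow_lt; auto).
    nra.
Qed.

Lemma star_fun_zfd (z : C) : in_disk z ->
  zfd_over_f star_fun (fun z => A z * PS q z)%C z = PS q z.
Proof.
  intros Hz.
  assert (NA : A z <> 0%C) by (rewrite star_quot_exp by auto; apply cexp_neq_0).
  assert (Q : z <> 0%C -> (z * (A z * PS q z) / star_fun z = PS q z)%C).
  { intros Nz. unfold star_fun. field. auto. }
  unfold zfd_over_f. destruct (Req_EM_T (Re z) 0) as [E1|N1].
  - destruct (Req_EM_T (Im z) 0) as [E2|N2].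
    + replace z with (RtoC 0) by (destruct z; unfold Re, Im, RtoC in *; simpl in *; congruence).
      rewrite PS_0; auto using cvdisk_q.
    + apply Q. intros E. apply N2. rewrite E; reflexivity.
  - apply Q. intros E. apply N1. rewrite E; reflexivity.
Qed.

Lemma star_fun_SG :
  subordinate (PS q) Psi -> class_SG star_fun.
Proof.
  intros [w [Hw [w0 [w1 Ew]]]].
  split; [split; [split|split]|].
  - intros z Hz. eexists. apply Cderiv_iff, star_fun_deriv, Hz.
  - apply star_fun_inj.
  - unfold star_fun. ring.
  - apply Cderiv_iff.
    assert (D0 : in_disk 0%C) by (unfold in_disk; rewrite Cmod_0; lra).
    refine (Cderiv_eq _ _ _ _ _ (star_fun_deriv 0 D0)).
    unfold A. rewrite !PS_0, star_coef_eq, q_0; auto using cvdisk_star, cvdisk_q. ring.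
  - exists (fun z => A z * PS q z)%C. split.
    + intros z Hz. apply Cderiv_iff, star_fun_deriv, Hz.
    + exists w. repeat split; auto. intros z Hz. rewrite star_fun_zfd; auto.
Qed.

End Starlike.

(** * Extremal functions, from the series a(z^m) *)

Definition sparse (m : nat) (a : nat -> C) (n : nat) : C :=
  if Nat.eqb (n mod m) 0 then a (n / m)%nat else 0%C.

Lemma sparse_sum (m : nat) (a : nat -> C) (z : C) (N : nat) : (0 < m)%nat ->
  sum_n (G := C_AbelianMonoid) (fun n => sparse m a n * z ^ n)%C N
  = sum_n (G := C_AbelianMonoid) (fun k => a k * (z ^ m) ^ k)%C (N / m).
Proof.
  intros Hm. induction N as [|N IH].
  - rewrite Nat.Div0.div_0_l, !sum_O. unfold sparse.
    rewrite Nat.Div0.mod_0_l, Nat.Div0.div_0_l. reflexivity.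
  - rewrite sum_Sn, IH. unfold sparse.
    assert (E1 := Nat.div_mod_eq (S N) m). assert (E2 := Nat.div_mod_eq N m).
    assert (B1 := Nat.mod_upper_bound (S N) m ltac:(lia)).
    assert (B2 := Nat.mod_upper_bound N m ltac:(lia)).
    destruct (Nat.eqb_spec (S N mod m) 0) as [M|M].
    + assert (E : (S N / m = S (N / m))%nat) by nia.
      rewrite E, sum_Sn. f_equal. rewrite <- E.
      rewrite <- Cpow_mult_r. do 2 f_equal. lia.
    + assert (E : (S N / m = N / m)%nat) by nia.
      rewrite E, Cmult_0_l. change (plus (G := C_AbelianMonoid)) with Cplus. apply Cplus_0_r.
Qed.

Lemma PS_sparse (m : nat) (a : nat -> C) (z : C) :
  (0 < m)%nat -> cvdisk a -> in_disk (z ^ m)%C ->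
  PS (sparse m a) z = PS a (z ^ m)%C.
Proof.
  intros Hm Ha Hz. apply Csum_unique.
  assert (L := Csum_correct _ (cvdisk_abs a _ Ha Hz)).
  unfold is_series in *.
  apply filterlim_ext with
    (fun N => sum_n (G := C_AbelianMonoid) (fun k => a k * (z ^ m) ^ k)%C (N / m)).
  - intros N. symmetry. apply sparse_sum, Hm.
  - eapply filterlim_comp; [|exact L].
    intros P [K HK]. exists (m * K)%nat. intros n Hn. apply HK.
    apply Nat.div_le_lower_bound; lia.
Qed.

Lemma Cmod_pow_disk (m : nat) (z : C) : (0 < m)%nat -> in_disk z -> in_disk (z ^ m)%C.
Proof.
  unfold in_disk. intros Hm Hz. rewrite Cmod_pow. destruct m as [|m]; [lia|].
  pose proof (Cmod_ge_0 z). simpl.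
  assert (Cmod z ^ m <= 1) by (rewrite <- (pow1 m); apply pow_incr; lra).
  assert (0 <= Cmod z ^ m) by (apply pow_le; auto). nra.
Qed.

Lemma Cpow_ex_deriv (m : nat) (z : C) : exists l, Cderiv (fun z => z ^ m)%C z l.
Proof.
  induction m as [|m [l IH]].
  - exists 0%C. apply (Cderiv_const 1%C).
  - eexists. apply (Cderiv_mult _ _ _ _ _ (Cderiv_id z) IH).
Qed.

Lemma extremal_SG (m : nat) : (0 < m)%nat ->
  class_SG (star_fun (sparse m g)).
Proof.
  intros Hm. apply star_fun_SG.
  - unfold sparse. rewrite Nat.Div0.mod_0_l, Nat.Div0.div_0_l. reflexivity.
  - intros n. unfold sparse. destruct (_ =? _)%nat; [apply g_le1|].
    rewrite Cmod_0; lra.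
  - intros z Hz. assert (Hzm := Cmod_pow_disk m z Hm Hz).
    rewrite PS_sparse by auto using cvdisk_g.
    assert (B := G_near_1 _ Hzm).
    assert (R := re_le_Cmod (PS g (z ^ m) - 1)%C).
    unfold Cminus in R at 1. rewrite re_plus, re_opp in R.
    change (Re (RtoC 1)) with 1 in R.
    apply Rabs_le_between in R. lra.
  - exists (fun z => z ^ m)%C. repeat split.
    + intros z Hz. destruct (Cpow_ex_deriv m z) as [l Hl]. exists l. apply Cderiv_iff, Hl.
    + destruct m as [|m]; [lia|]. simpl. ring.
    + intros z Hz. apply Cmod_pow_disk; auto.
    + intros z Hz. assert (Hzm := Cmod_pow_disk m z Hm Hz).
      rewrite PS_sparse, Psi_series; auto using cvdisk_g.
Qed.

Lemma g_1 : g 1%nat = RtoC (/ 2).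
Proof. simpl. rewrite beta_eq. simpl. f_equal. field. Qed.

Lemma sharp_examples (n : nat) : (2 <= n <= 5)%nat ->
  exists (f : C -> C) (a : nat -> C), class_SG f /\ coeffs_of f a /\
    Cmod (a n) = 1 / (2 * (INR n - 1)).
Proof.
  (* For q(z) = G(z^m) the first nonconstant term is g_1 z^m. All coefficients of f(z)/z of index 1,
     ..., m-1 therefore vanish, and the one of index m = n-1 is g_1/m = 1/(2m). *)
  intros Hn. set (m := pred n).
  exists (star_fun (sparse m g)), (scons 0 (star_coef (sparse m g))).
  split; [apply extremal_SG; unfold m; lia|split].
  - apply star_fun_coeffs.
    intros k. unfold sparse. destruct (_ =? _)%nat; [apply g_le1|].
    rewrite Cmod_0; lra.
  - assert (E : scons 0 (star_coef (sparse m g)) n = RtoC (/ INR m * / 2)).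
    { unfold m. rewrite RtoC_mult, <- g_1.
      destruct n as [|[|[|[|[|[|n]]]]]]; try lia; cbn [scons pred].
      - rewrite star_coef_eq. cbn [conv]. rewrite star_coef_eq. unfold sparse. cbn -[INR g]. ring.
      - do 3 (rewrite ?(star_coef_eq _ 2), ?(star_coef_eq _ 1), ?(star_coef_eq _ 0); cbn [conv]).
        unfold sparse. cbn -[INR g]. ring.
      - do 3 (rewrite ?(star_coef_eq _ 3), ?(star_coef_eq _ 2), ?(star_coef_eq _ 1), ?(star_coef_eq _ 0); cbn [conv]).
        unfold sparse. cbn -[INR g]. ring.
      - do 3 (rewrite ?(star_coef_eq _ 4), ?(star_coef_eq _ 3), ?(star_coef_eq _ 2), ?(star_coef_eq _ 1), ?(star_coef_eq _ 0); cbn [conv]).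
        unfold sparse. cbn -[INR g]. ring. }
    rewrite E, Cmod_R. unfold m.
    assert (P : 0 < INR (pred n)) by (apply lt_0_INR; lia).
    replace (INR n) with (INR (pred n) + 1) by (rewrite <- S_INR; f_equal; lia).
    rewrite Rabs_pos_eq; [field; lra|].
    apply Rlt_le, Rmult_lt_0_compat; [apply Rinv_0_lt_compat; auto|lra].
Qed.

(** * Taylor jets, circle means and Bessel's inequality *)

(** The origin is excluded because the quotients by z to which this is applied have an arbitrary
    value there. *)
Definition bounded_near0 (f : C -> C) : Prop :=
  exists M d, 0 < d /\ forall z, 0 < Cmod z < d -> Cmod (f z) <= M.

(* f(z) = c_0 + ... + c_{n-1} z^{n-1} + O(z^n) as z -> 0, z <> 0. *)
Fixpoint jet (n : nat) (f : C -> C) (c : nat -> C) : Prop :=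
  match n with
  | O => bounded_near0 f
  | S m => jet m (fun z => (f z - c 0%nat) / z)%C (fun k => c (S k))
  end.

Lemma jet_ext_near (n : nat) (f g : C -> C) (c c' : nat -> C) (d : R) :
  0 < d -> (forall z, 0 < Cmod z < d -> f z = g z) ->
  (forall k, (k < n)%nat -> c k = c' k) -> jet n f c -> jet n g c'.
Proof.
  intros Hd. revert f g c c'. induction n as [|n IH]; intros f g c c' E Ec H.
  - destruct H as [M [d' [Hd' H]]]. exists M, (Rmin d d').
    split; [apply Rmin_glb_lt; auto|]. intros z Hz.
    assert (B := Rmin_l d d'). assert (B' := Rmin_r d d').
    rewrite <- E by lra. apply H; lra.
  - simpl in *. eapply IH; [| |exact H].
    + intros z Hz. cbv beta. rewrite E, Ec by (auto; lia). reflexivity.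
    + intros k Hk. apply Ec; lia.
Qed.

Lemma jet_ext (n : nat) (f g : C -> C) (c c' : nat -> C) :
  (forall z : C, z <> 0%C -> f z = g z) ->
  (forall k, (k < n)%nat -> c k = c' k) -> jet n f c -> jet n g c'.
Proof.
  intros E. apply jet_ext_near with 1; [lra|]. intros z Hz. apply E, Cmod_gt_0, Hz.
Qed.

Lemma bounded_plus (f g : C -> C) :
  bounded_near0 f -> bounded_near0 g -> bounded_near0 (fun z => f z + g z)%C.
Proof.
  intros [M [d [Hd H]]] [M' [d' [Hd' H']]].
  exists (M + M'), (Rmin d d'). split; [apply Rmin_glb_lt; auto|]. intros z Hz.
  assert (B := Rmin_l d d'). assert (B' := Rmin_r d d').
  eapply Rle_trans; [apply Cmod_triangle|].
  apply Rplus_le_compat; [apply H|apply H']; lra.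
Qed.

Lemma bounded_mult (f g : C -> C) :
  bounded_near0 f -> bounded_near0 g -> bounded_near0 (fun z => f z * g z)%C.
Proof.
  intros [M [d [Hd H]]] [M' [d' [Hd' H']]].
  exists (M * M'), (Rmin d d'). split; [apply Rmin_glb_lt; auto|]. intros z Hz.
  assert (B := Rmin_l d d'). assert (B' := Rmin_r d d').
  rewrite Cmod_mult.
  apply Rmult_le_compat; try apply Cmod_ge_0; [apply H|apply H']; lra.
Qed.

Lemma bounded_const (c : C) : bounded_near0 (fun _ => c).
Proof. exists (Cmod c), 1. split; [lra|]. intros; lra. Qed.

Lemma bounded_id : bounded_near0 (fun z => z).
Proof. exists 1, 1. split; [lra|]. intros; lra. Qed.

Lemma bounded_ext (f g : C -> C) :
  (forall z : C, z <> 0%C -> f z = g z) -> bounded_near0 f -> bounded_near0 g.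
Proof. intros E. exact (jet_ext 0 f g (fun _ => 0%C) (fun _ => 0%C) E (fun _ _ => eq_refl)). Qed.

Lemma jet_bounded (n : nat) (f : C -> C) (c : nat -> C) : jet n f c -> bounded_near0 f.
Proof.
  revert f c; induction n as [|n IH]; intros f c H; [exact H|].
  simpl in H. apply IH in H.
  apply (bounded_ext (fun z => c 0%nat + z * ((f z - c 0%nat) / z))%C).
  - intros z Hz. field. exact Hz.
  - apply bounded_plus; [apply bounded_const|].
    apply (bounded_mult (fun z => z)); [apply bounded_id|exact H].
Qed.

Lemma jet_weaken (n : nat) (f : C -> C) (c : nat -> C) : jet (S n) f c -> jet n f c.
Proof.
  revert f c; induction n as [|n IH]; intros f c H.
  - exact (jet_bounded 1 f c H).
  - simpl. apply IH. exact H.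
Qed.

Lemma jet_plus (n : nat) (f g : C -> C) (c d : nat -> C) :
  jet n f c -> jet n g d -> jet n (fun z => f z + g z)%C (fun k => c k + d k)%C.
Proof.
  revert f g c d; induction n as [|n IH]; intros f g c d Hf Hg.
  - apply bounded_plus; auto.
  - simpl in *. specialize (IH _ _ _ _ Hf Hg).
    eapply jet_ext; [| |exact IH]; [|reflexivity].
    intros z Hz. cbv beta. field. exact Hz.
Qed.

Lemma jet_scal (n : nat) (k : C) (f : C -> C) (c : nat -> C) :
  jet n f c -> jet n (fun z => k * f z)%C (fun j => k * c j)%C.
Proof.
  revert f c; induction n as [|n IH]; intros f c Hf.
  - apply (bounded_mult (fun _ => k)); [apply bounded_const|exact Hf].
  - simpl in *. specialize (IH _ _ Hf).
    eapply jet_ext; [| |exact IH]; [|reflexivity].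
    intros z Hz. cbv beta. field. exact Hz.
Qed.

Lemma jet_zmult (n : nat) (f : C -> C) (c : nat -> C) (k : C) :
  jet n f c -> jet (S n) (fun z => k + z * f z)%C (scons k c).
Proof.
  intros H. simpl. eapply jet_ext; [| |exact H]; [|reflexivity].
  intros z Hz. cbv beta. field. exact Hz.
Qed.

Lemma jet_mult (n : nat) (f g : C -> C) (c d : nat -> C) :
  jet n f c -> jet n g d -> jet n (fun z => f z * g z)%C (conv c d).
Proof.
  revert f g c d; induction n as [|n IH]; intros f g c d Hf Hg.
  - apply bounded_mult; auto.
  - assert (Hg' := jet_weaken _ _ _ Hg). simpl in Hf. simpl in Hg.
    assert (K1 := IH _ _ _ _ Hf Hg').
    assert (K2 := jet_scal n (c 0%nat) _ _ Hg).
    simpl. eapply jet_ext; [| |exact (jet_plus _ _ _ _ _ K2 K1)].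
    + intros z Hz. cbv beta. field. exact Hz.
    + reflexivity.
Qed.

(** The two difference quotients by z are bounded, and their difference is (c'_0 - c_0)/z up to
    sign, which is bounded near 0 only if it vanishes. The next coefficients are then compared on
    one common quotient. *)
Lemma jet_unique (n : nat) (f : C -> C) (c c' : nat -> C) :
  jet n f c -> jet n f c' -> forall k, (k < n)%nat -> c k = c' k.
Proof.
  revert f c c'; induction n as [|n IH]; intros f c c' H H' k Hk; [lia|].
  assert (E0 : c 0%nat = c' 0%nat).
  { assert (B := jet_bounded _ _ _ H). assert (B' := jet_bounded _ _ _ H').
    simpl in H, H'. apply jet_bounded in H. apply jet_bounded in H'.
    destruct (bounded_plus _ _ H
      (bounded_mult _ _ (bounded_const (- (1))%C) H')) as [M [d [Hd HM]]].
    apply Ceq_minus, Cmod_eq_0.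
    destruct (Rle_lt_or_eq_dec 0 _ (Cmod_ge_0 (c 0%nat - c' 0%nat)%C)) as [P|P]; [|auto].
    exfalso. set (e := Cmod (c 0%nat - c' 0%nat)%C) in *.
    assert (HM0 : 0 <= Rabs M) by apply Rabs_pos.
    set (t := Rmin (d / 2) (e / (2 * (Rabs M + 1)))).
    assert (Pt : 0 < e / (2 * (Rabs M + 1))) by (apply Rdiv_lt_0_compat; lra).
    assert (T0 : 0 < t) by (apply Rmin_glb_lt; lra).
    assert (T1 : t <= d / 2) by apply Rmin_l.
    assert (T2 : t <= e / (2 * (Rabs M + 1))) by apply Rmin_r.
    assert (Et : Cmod (RtoC t) = t) by (rewrite Cmod_R; apply Rabs_pos_eq; lra).
    assert (Nt : RtoC t <> 0%C) by (intro Q; apply RtoC_inj in Q; lra).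
    specialize (HM (RtoC t)). rewrite Et in HM. specialize (HM ltac:(lra)).
    replace ((f (RtoC t) - c 0%nat) / RtoC t + - (1) * ((f (RtoC t) - c' 0%nat) / RtoC t))%C
      with ((c' 0%nat - c 0%nat) / RtoC t)%C in HM by (field; auto).
    rewrite Cmod_div, Et in HM by auto.
    rewrite <- Cmod_opp, Copp_minus_distr in HM. fold e in HM.
    assert (L : e <= M * t).
    { apply Rmult_le_reg_r with (/ t); [apply Rinv_0_lt_compat; auto|].
      rewrite Rmult_assoc, Rinv_r, Rmult_1_r by lra. exact HM. }
    assert (L2 : (Rabs M + 1) * t <= e / 2).
    { apply Rle_trans with ((Rabs M + 1) * (e / (2 * (Rabs M + 1)))).
      - apply Rmult_le_compat_l; lra.
      - right; field; lra. }
    assert (LM := Rle_abs M). nra. }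
  destruct k as [|k]; auto.
  apply (IH (fun z => (f z - c 0%nat) / z)%C (fun k => c (S k)) (fun k => c' (S k))); [exact H| |lia].
  rewrite E0. exact H'.
Qed.

Lemma jet_PS (n : nat) (a : nat -> C) : cvdisk a -> jet n (PS a) a.
Proof.
  revert a; induction n as [|n IH]; intros a Ha.
  - assert (D0 : in_disk 0%C) by (unfold in_disk; rewrite Cmod_0; lra).
    destruct (Cderiv_cont _ _ _ (PS_deriv a 0 Ha D0) 1 Rlt_0_1) as [d [Hd K]].
    exists (Cmod (PS a 0) + 1), d. split; auto. intros z Hz.
    specialize (K z (proj2 Hz)). rewrite Cplus_0_l in K.
    replace (PS a z) with (PS a 0 + (PS a z - PS a 0))%C by ring.
    eapply Rle_trans; [apply Cmod_triangle|]. lra.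
  - simpl. assert (Hs := proj1 (cvdisk_shift a) Ha).
    apply (jet_ext_near n (PS (fun k => a (S k))) _ (fun k => a (S k)) _ 1); auto; [lra|].
    intros z Hz. rewrite (PS_incr a z) by (auto; apply Hz). field.
    apply Cmod_gt_0, Hz.
Qed.

(* Taylor coefficients, up to order n, of z |-> sum_k a_k (z v(z))^k. *)
Fixpoint comp_coef (n : nat) (a c : nat -> C) : nat -> C :=
  match n with
  | O => fun _ => 0%C
  | S m => scons (a 0%nat) (conv c (comp_coef m (fun k => a (S k)) c))
  end.

(** Horner's scheme: a(zv) = a_0 + z v a~(zv), with a~ the shifted series. The explicit z gains one
    order at each step, so n coefficients of v determine n+1 of the composite. Boundedness of v
    keeps z v(z) in the disk for small z. *)
Lemma jet_comp (n : nat) (v : C -> C) (a c : nat -> C) :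
  jet n v c -> cvdisk a ->
  jet (S n) (fun z => PS a (z * v z)%C) (comp_coef (S n) a c).
Proof.
  intros Hv Ha.
  assert (B := jet_bounded _ _ _ Hv).
  assert (W : exists d, 0 < d /\ forall z, 0 < Cmod z < d -> in_disk (z * v z)%C).
  { destruct B as [M [d [Hd HM]]].
    assert (P : 0 < / (Rabs M + 1)).
    { apply Rinv_0_lt_compat. assert (Q := Rabs_pos M). lra. }
    exists (Rmin d (/ (Rabs M + 1))). split; [apply Rmin_glb_lt; auto|].
    intros z Hz. assert (B := Rmin_l d (/ (Rabs M + 1))). assert (B' := Rmin_r d (/ (Rabs M + 1))).
    unfold in_disk. rewrite Cmod_mult. specialize (HM z ltac:(lra)).
    assert (LM := Rle_abs M). assert (Q := Rabs_pos M).
    apply Rle_lt_trans with (Cmod z * Rabs M); [apply Rmult_le_compat_l; lra|].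
    apply Rle_lt_trans with (/ (Rabs M + 1) * Rabs M); [apply Rmult_le_compat_r; lra|].
    apply Rmult_lt_reg_l with (Rabs M + 1); [lra|].
    rewrite <- Rmult_assoc, Rinv_r; lra. }
  destruct W as [d [Hd W]].
  assert (Step : forall m a' e, cvdisk a' -> jet m v c ->
            jet m (fun z => PS (fun k => a' (S k)) (z * v z)%C) e ->
            jet (S m) (fun z => PS a' (z * v z)%C) (scons (a' 0%nat) (conv c e))).
  { intros m a' e Ha' Hm He.
    assert (K := jet_zmult _ _ _ (a' 0%nat) (jet_mult _ _ _ _ _ Hm He)).
    eapply jet_ext_near; [exact Hd| | |exact K]; [|reflexivity].
    intros z Hz. cbv beta. rewrite (PS_incr a' (z * v z)%C) by auto. ring. }
  revert a Ha. induction n as [|n IH]; intros a Ha.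
  - assert (Hs := proj1 (cvdisk_shift a) Ha).
    change (comp_coef 1 a c) with (scons (a 0%nat) (conv c (comp_coef 0 (fun k => a (S k)) c))).
    apply Step; auto.
    assert (D0 : in_disk 0%C) by (unfold in_disk; rewrite Cmod_0; lra).
    set (s := fun k => a (S k)) in *.
    destruct (Cderiv_cont _ _ _ (PS_deriv s 0 Hs D0) 1 Rlt_0_1) as [d' [Hd' K]].
    destruct B as [M [d2 [Hd2 HM]]].
    assert (P : 0 < d' / (Rabs M + 1)).
    { apply Rdiv_lt_0_compat; auto. assert (Q := Rabs_pos M). lra. }
    exists (Cmod (PS s 0) + 1), (Rmin d2 (d' / (Rabs M + 1))).
    split; [apply Rmin_glb_lt; auto|]. intros z Hz.
    assert (B := Rmin_l d2 (d' / (Rabs M + 1))). assert (B' := Rmin_r d2 (d' / (Rabs M + 1))).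
    specialize (HM z ltac:(lra)).
    specialize (K (z * v z)%C). rewrite Cplus_0_l in K.
    replace (PS s (z * v z)) with (PS s 0 + (PS s (z * v z) - PS s 0))%C by ring.
    eapply Rle_trans; [apply Cmod_triangle|].
    apply Rplus_le_compat_l, Rlt_le, K. rewrite Cmod_mult.
    assert (LM := Rle_abs M). assert (Q := Rabs_pos M).
    apply Rle_lt_trans with (Cmod z * Rabs M); [apply Rmult_le_compat_l; lra|].
    apply Rle_lt_trans with (d' / (Rabs M + 1) * Rabs M); [apply Rmult_le_compat_r; lra|].
    apply Rlt_le_trans with (d' / (Rabs M + 1) * (Rabs M + 1)).
    + apply Rmult_lt_compat_l; lra.
    + right; field; lra.
  - assert (Hs := proj1 (cvdisk_shift a) Ha).
    change (comp_coef (S (S n)) a c)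
      with (scons (a 0%nat) (conv c (comp_coef (S n) (fun k => a (S k)) c))).
    apply Step; auto. apply IH; auto. apply jet_weaken, Hv.
Qed.

(* Twice complex differentiable on the punctured disk; the second derivative
   makes the first one continuous, which is all that is needed for Cauchy. *)
Definition hol2 (f : C -> C) : Prop :=
  exists f1 f2 : C -> C, forall z, 0 < Cmod z < 1 -> Cderiv f z (f1 z) /\ Cderiv f1 z (f2 z).

Lemma hol2_const (c : C) : hol2 (fun _ => c).
Proof. exists (fun _ => 0%C), (fun _ => 0%C). intros z _. split; apply Cderiv_const. Qed.

Lemma hol2_id : hol2 (fun z => z).
Proof.
  exists (fun _ => 1%C), (fun _ => 0%C). intros z _. split; [apply Cderiv_id|apply Cderiv_const].
Qed.

Lemma hol2_plus (f g : C -> C) : hol2 f -> hol2 g -> hol2 (fun z => f z + g z)%C.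
Proof.
  intros [f1 [f2 Hf]] [g1 [g2 Hg]].
  exists (fun z => f1 z + g1 z)%C, (fun z => f2 z + g2 z)%C. intros z Hz.
  destruct (Hf z Hz), (Hg z Hz). split; apply Cderiv_plus; auto.
Qed.

Lemma hol2_mult (f g : C -> C) : hol2 f -> hol2 g -> hol2 (fun z => f z * g z)%C.
Proof.
  intros [f1 [f2 Hf]] [g1 [g2 Hg]].
  exists (fun z => f1 z * g z + f z * g1 z)%C,
    (fun z => (f2 z * g z + f1 z * g1 z) + (f1 z * g1 z + f z * g2 z))%C. intros z Hz.
  destruct (Hf z Hz), (Hg z Hz). split; [apply Cderiv_mult; auto|].
  apply Cderiv_plus; apply Cderiv_mult; auto.
Qed.

Lemma hol2_inv : hol2 (fun z => / z)%C.
Proof.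
  assert (N : forall z, 0 < Cmod z < 1 -> z <> 0%C) by (intros z Hz; apply Cmod_gt_0, Hz).
  exists (fun z => - / (z * z))%C.
  exists (fun z => - (1) * (- / (z * z * (z * z)) * (2 * z)))%C. intros z Hz.
  split; [apply Cderiv_inv; auto|].
  assert (Nz := N z Hz).
  assert (D1 := Cderiv_comp (fun u => / u)%C (fun u => u * u)%C z _ _
     (Cderiv_inv _ (Cmult_neq_0 _ _ Nz Nz)) (Cderiv_sqr z)).
  assert (D2 := Cderiv_comp (fun u => - (1) * u)%C _ z _ _ (Cderiv_scal _ _) D1).
  refine (Cderiv_ext _ _ _ _ _ D2). intros u. cbv beta. ring.
Qed.

(** * Circle means: |z| = e^x is the image under exp of the segment x + it, 0 <= t <= 2 pi *)

Lemma point_path (x t : R) : ((x, t) : C) = (Ci * RtoC t + RtoC x * 1)%C.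
Proof. unfold Ci, RtoC, Cplus, Cmult; cbn [fst snd]. f_equal; ring. Qed.

Lemma point_path' (x t : R) : ((x, t) : C) = (RtoC x + RtoC t * Ci)%C.
Proof. unfold Ci, RtoC, Cplus, Cmult; cbn [fst snd]. f_equal; ring. Qed.

Lemma continuous_line (U U' : C -> C) (x : R) :
  (forall t, Cderiv U (x, t) (U' (x, t))) ->
  forall t, continuous (U := R_UniformSpace) (fun t => Re (U (x, t))) t.
Proof.
  intros H t. apply (ex_derive_continuous (V := R_NormedModule)).
  exists (Re (U' (x, t) * Ci)%C).
  apply (is_derive_ext (fun t => Re (U (RtoC x + RtoC t * Ci)%C))).
  - intros s. rewrite point_path'. reflexivity.
  - apply Cderiv_Re_path. rewrite <- point_path'. apply H.
Qed.

(** On a vertical line -i W is a primitive of W' in the variable t, so the integral is a difference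
    of equal end values. The second derivative supplies the continuity of the integrand. *)
Lemma is_RInt_periodic (W W' W'' : C -> C) (x : R) :
  (forall t, Cderiv W (x, t) (W' (x, t))) -> (forall t, Cderiv W' (x, t) (W'' (x, t))) ->
  W (x, 2 * PI) = W (x, 0) ->
  is_RInt (fun t => Re (W' (x, t))) 0 (2 * PI) 0.
Proof.
  intros H H' E.
  replace 0 with (minus (Re (- Ci * W (x, 2 * PI)%R)%C) (Re (- Ci * W (x, 0)%R)%C)) at 2.
  2:{ rewrite E. apply (minus_eq_zero (G := R_AbelianGroup)). }
  apply (is_RInt_derive (V := R_CompleteNormedModule) (fun t => Re (- Ci * W (x, t))%C)).
  - intros t _.
    apply (is_derive_ext (fun t => Re (- Ci * W (RtoC x + RtoC t * Ci))%C)).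
    { intros s. rewrite point_path'. reflexivity. }
    assert (D : Cderiv W (RtoC x + RtoC t * Ci)%C (W' (x, t)))
      by (rewrite <- point_path'; apply H).
    assert (D1 := Cderiv_comp (fun u => - Ci * u)%C W _ _ _ (Cderiv_scal _ _) D).
    assert (D2 := Cderiv_Re_path _ _ _ _ _ D1).
    replace (- Ci * W' (x, t) * Ci)%C with (W' (x, t)) in D2; [exact D2|].
    destruct (W' (x, t)) as [p q]. unfold Ci, Copp, Cmult; cbn [fst snd]. f_equal; ring.
  - intros t _. apply (continuous_line W' W'' x H').
Qed.

Section MeanValue.

Variables U U' U'' : C -> C.
Hypothesis U_deriv : forall z, Re z < 0 -> Cderiv U z (U' z).
Hypothesis U'_deriv : forall z, Re z < 0 -> Cderiv U' z (U'' z).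
Hypothesis U_per : forall x, U (x, 2 * PI) = U (x, 0).

Lemma ex_RInt_line (x : R) : x < 0 -> ex_RInt (fun t => Re (U (x, t))) 0 (2 * PI).
Proof.
  intros Hx. apply (ex_RInt_continuous (V := R_CompleteNormedModule)).
  intros t _. apply (continuous_line U U' x). intros s. apply U_deriv. exact Hx.
Qed.

(** Cauchy's theorem in this setting: differentiating under the integral in x gives the integral of
    Re U' over a vertical period, which vanishes because U takes equal values at its ends. *)
Lemma mean_derive (x : R) : x < 0 ->
  is_derive (fun x => RInt (fun t => Re (U (x, t))) 0 (2 * PI)) x 0.
Proof.
  intros Hx.
  assert (D : forall u t, u < 0 -> is_derive (fun s => Re (U (s, t))) u (Re (U' (u, t)))).
  { intros u t Hu.
    apply (is_derive_ext (fun s => Re (U (Ci * RtoC t + RtoC s * 1)%C))).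
    { intros s. rewrite point_path. reflexivity. }
    assert (K : Cderiv U (Ci * RtoC t + RtoC u * 1)%C (U' (u, t)))
      by (rewrite <- point_path; apply U_deriv, Hu).
    assert (K' := Cderiv_Re_path _ _ _ _ _ K). rewrite Cmult_1_r in K'. exact K'. }
  assert (Loc : locally x (fun u : R => u < 0)).
  { exists (mkposreal (- x) ltac:(lra)). intros u Hu.
    change (Rabs (u - x) < - x) in Hu. apply Rabs_lt_between in Hu. lra. }
  evar_last.
  - apply (is_derive_RInt_param (fun x t => Re (U (x, t)))).
    + generalize Loc. apply filter_imp. intros u Hu t _. eexists. apply D, Hu.
    + intros t _. intros eps.
      destruct (Cderiv_cont _ _ _ (U'_deriv (x, t) Hx) eps (cond_pos eps)) as [d [Hd K]].
      (* Half of d in each coordinate keeps the displacement below d in modulus, and -x keeps u in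
         the left half plane. *)
      assert (Pd : 0 < Rmin (d / 2) (- x)) by (apply Rmin_glb_lt; lra).
      exists (mkposreal _ Pd). intros u s Hu Hs. simpl in Hu, Hs.
      assert (B := Rmin_l (d / 2) (- x)). assert (B' := Rmin_r (d / 2) (- x)).
      assert (Hu0 : u < 0).
      { apply Rabs_lt_between in Hu. lra. }
      assert (Eu : Derive (fun z : R => Re (U (z, s))) u = Re (U' (u, s)))
        by (apply is_derive_unique, D, Hu0).
      assert (Ex : Derive (fun z : R => Re (U (z, t))) x = Re (U' (x, t)))
        by (apply is_derive_unique, D, Hx).
      change (Rabs (Derive (fun z : R => Re (U (z, s))) u
        - Derive (fun z : R => Re (U (z, t))) x) < eps).
      rewrite Eu, Ex.
      specialize (K (u - x, s - t)).
      replace (Cplus (x, t) (u - x, s - t)) with ((u, s) : C) in K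
        by (unfold Cplus; cbn [fst snd]; f_equal; ring).
      unfold Rminus at 1. rewrite <- re_opp, <- re_plus.
      eapply Rle_lt_trans; [apply re_le_Cmod|]. apply K.
      eapply Rle_lt_trans; [apply Cmod_le_sum|]. lra.
    + generalize Loc. apply filter_imp. intros u Hu. apply ex_RInt_line, Hu.
  - apply is_RInt_unique.
    apply (is_RInt_ext (fun t => Re (U' (x, t)))).
    + intros t _. symmetry. apply is_derive_unique, D, Hx.
    + apply (is_RInt_periodic U U' U''); auto.
Qed.

(** The integral is independent of x. As x tends to minus infinity the circle |z| = e^x shrinks to
    0, where U differs from c by at most K |z|. *)
Lemma mean_value (c : C) (K X : R) :
  (forall z, Re z < X -> Cmod (U z - c)%C <= K * exp (Re z)) ->
  forall x, x < 0 -> is_RInt (fun t => Re (U (x, t))) 0 (2 * PI) (2 * PI * Re c).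
Proof.
  intros HK.
  set (M := fun x => RInt (fun t => Re (U (x, t))) 0 (2 * PI)).
  assert (Pi := PI_RGT_0).
  assert (Cst : forall x y, x < y < 0 -> M x = M y).
  { intros x y Hxy. apply (eq_is_derive (V := R_NormedModule) M x y); [|lra].
    intros t Ht. apply mean_derive; lra. }
  assert (Bd : forall x, x < 0 -> x < X -> Rabs (M x - 2 * PI * Re c) <= 2 * PI * (K * exp x)).
  { intros x Hx HX.
    assert (I := RInt_correct _ _ _ (ex_RInt_line x Hx)). fold (M x) in I.
    assert (Q : forall t, Rabs (Re (U (x, t)) - Re c) <= K * exp x).
    { intros t. unfold Rminus. rewrite <- re_opp, <- re_plus.
      eapply Rle_trans; [apply re_le_Cmod|]. apply (HK (x, t)). exact HX. }
    assert (L1 : M x <= scal (2 * PI - 0) (Re c + K * exp x)).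
    { apply (is_RInt_le _ _ 0 (2 * PI) _ _ ltac:(lra) I
        (is_RInt_const (V := R_NormedModule) 0 (2 * PI) (Re c + K * exp x))).
      intros t _. specialize (Q t). apply Rabs_le_between in Q. lra. }
    assert (L2 : scal (2 * PI - 0) (Re c - K * exp x) <= M x).
    { apply (is_RInt_le _ _ 0 (2 * PI) _ _ ltac:(lra)
        (is_RInt_const (V := R_NormedModule) 0 (2 * PI) (Re c - K * exp x)) I).
      intros t _. specialize (Q t). apply Rabs_le_between in Q. lra. }
    change (M x <= (2 * PI - 0) * (Re c + K * exp x)) in L1.
    change ((2 * PI - 0) * (Re c - K * exp x) <= M x) in L2.
    apply Rabs_le_between. lra. }
  intros x Hx.
  assert (E : M x = 2 * PI * Re c).
  { destruct (Req_dec (M x) (2 * PI * Re c)) as [Q|N]; auto. exfalso.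
    assert (P : 0 < Rabs (M x - 2 * PI * Re c)) by (apply Rabs_pos_lt; lra).
    set (e := Rabs (M x - 2 * PI * Re c)) in *.
    assert (AK := Rle_abs K). assert (AK0 := Rabs_pos K).
    set (b := e / (2 * PI * (Rabs K + 1))).
    assert (Pb : 0 < b).
    { apply Rdiv_lt_0_compat; auto. apply Rmult_lt_0_compat; lra. }
    (* A circle so small that e^y <= b, whence 2 pi K e^y < e, contradicting the estimate at y. *)
    set (y := Rmin (x - 1) (Rmin (X - 1) (ln b))).
    assert (Y1 : y <= x - 1) by apply Rmin_l.
    assert (Y2 : y <= X - 1) by (eapply Rle_trans; [apply Rmin_r|apply Rmin_l]).
    assert (Y3 : y <= ln b) by (eapply Rle_trans; [apply Rmin_r|apply Rmin_r]).
    assert (Bd' := Bd y ltac:(lra) ltac:(lra)).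
    rewrite (Cst y x) in Bd' by lra. fold e in Bd'.
    assert (Ey : exp y <= b).
    { rewrite <- (exp_ln b) by auto. destruct Y3 as [Y3|Y3].
      - left; apply exp_increasing; auto.
      - right; rewrite Y3; auto. }
    assert (Py := exp_pos y).
    assert (F : 2 * PI * ((Rabs K + 1) * b) = e) by (unfold b; field; lra).
    assert (F2 : K * exp y < (Rabs K + 1) * b).
    { apply Rle_lt_trans with (Rabs K * b); [|lra].
      apply Rle_trans with (Rabs K * exp y);
        [apply Rmult_le_compat_r; lra|apply Rmult_le_compat_l; lra]. }
    nra. }
  rewrite <- E. apply (RInt_correct (V := R_CompleteNormedModule)), ex_RInt_line, Hx.
Qed.

End MeanValue.

Lemma cexp_2pi (x : R) : cexp (x, 2 * PI) = cexp (x, 0).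
Proof. unfold cexp, Re, Im; cbn [fst snd]. rewrite cos_2PI, sin_2PI, cos_0, sin_0. auto. Qed.

Lemma cexp_disk (z : C) : Re z < 0 -> 0 < Cmod (cexp z) < 1.
Proof.
  intros H. rewrite Cmod_cexp. split; [apply exp_pos|].
  rewrite <- exp_0. apply exp_increasing, H.
Qed.

(** The power e^(-(m+1) zeta) has a periodic primitive, namely itself divided by -(m+1). *)
Lemma mean_negative_power (k : C) (m : nat) (x : R) :
  is_RInt (fun t => Re (k * (/ cexp (x, t)) ^ S m)%C) 0 (2 * PI) 0.
Proof.
  assert (P0 : forall z, Cderiv (fun z => / cexp z)%C z (- (1) * / cexp z)%C).
  { intros z. assert (N := cexp_neq_0 z).
    refine (Cderiv_eq _ _ _ _ _ (Cderiv_comp (fun u => / u)%C cexp z _ _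
      (Cderiv_inv _ N) (Cderiv_cexp z))). field. exact N. }
  assert (P : forall n z, Cderiv (fun z => (/ cexp z) ^ n)%C z
                 (- RtoC (INR n) * (/ cexp z) ^ n)%C).
  { induction n as [|n IH]; intros z.
    - refine (Cderiv_eq _ _ _ _ _ (Cderiv_const 1 z)). simpl. ring.
    - refine (Cderiv_eq _ _ _ _ _ (Cderiv_mult _ _ z _ _ (P0 z) (IH z))).
      rewrite S_INR, RtoC_plus. simpl. ring. }
  assert (Nm : RtoC (INR (S m)) <> 0%C).
  { intro E. apply RtoC_inj in E. apply not_0_INR in E; auto. }
  assert (Q : forall k z, Cderiv (fun z => k * (/ cexp z) ^ S m)%C z
                 (k * (- RtoC (INR (S m)) * (/ cexp z) ^ S m))%C).
  { intros k' z. apply (Cderiv_comp (fun u => k' * u)%C); [apply Cderiv_scal|apply P]. }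
  apply (is_RInt_periodic (fun z => (- k / RtoC (INR (S m))) * (/ cexp z) ^ S m)%C
           (fun z => k * (/ cexp z) ^ S m)%C
           (fun z => k * (- RtoC (INR (S m)) * (/ cexp z) ^ S m))%C).
  - intros t. refine (Cderiv_eq _ _ _ _ _ (Q _ _)). cbv beta. field. exact Nm.
  - intros t. apply Q.
  - rewrite cexp_2pi. reflexivity.
Qed.

(** Cauchy's coefficient formula, with k turning the real part in any desired direction. For j = 0
    it is the mean value property. Otherwise V z^(-j-1) = ((V - c_0)/z) z^(-j) + c_0 z^(-j-1): the
    last term has mean zero, and the quotient has the shifted jet. *)
Lemma mean_coef (n : nat) (V : C -> C) (c : nat -> C) (j : nat) (k : C) (x : R) :
  hol2 V -> jet n V c -> (j < n)%nat -> x < 0 ->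
  is_RInt (fun t => Re (k * (V (cexp (x, t)) * (/ cexp (x, t)) ^ j))%C)
    0 (2 * PI) (2 * PI * Re (k * c j)%C).
Proof.
  intros Hol Hj Hjn Hx. revert V c j Hol Hj Hjn.
  induction n as [|n IH]; intros V c j Hol Hj Hjn; [lia|].
  assert (H1 : hol2 (fun z => (V z - c 0%nat) / z)%C).
  { apply (hol2_mult (fun z => V z + - c 0%nat)%C); [|apply hol2_inv].
    apply hol2_plus; [exact Hol|apply hol2_const]. }
  simpl in Hj.
  destruct j as [|j].
  - destruct Hol as [V1 [V2 HV]].
    destruct (jet_bounded _ _ _ Hj) as [M [d [Hd HM]]].
    set (U1 := fun z => (k * (V1 (cexp z) * cexp z))%C).
    set (U2 := fun z => (k * (V2 (cexp z) * cexp z * cexp z + V1 (cexp z) * cexp z))%C).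
    apply (is_RInt_ext (fun t => Re (k * V (cexp (x, t)))%C)).
    { intros t _. apply (f_equal Re). change ((/ cexp (x, t)) ^ 0)%C with (RtoC 1). ring. }
    apply (mean_value (fun z => k * V (cexp z))%C U1 U2) with (K := Cmod k * M) (X := ln d); auto.
    + intros z Hz. destruct (HV _ (cexp_disk z Hz)) as [D1 _].
      apply (Cderiv_comp (fun u => k * u)%C (fun z => V (cexp z))); [apply Cderiv_scal|].
      apply Cderiv_comp; [exact D1|apply Cderiv_cexp].
    + intros z Hz. destruct (HV _ (cexp_disk z Hz)) as [_ D2].
      apply (Cderiv_comp (fun u => k * u)%C (fun z => V1 (cexp z) * cexp z)%C); [apply Cderiv_scal|].
      assert (D3 := Cderiv_comp V1 cexp z _ _ D2 (Cderiv_cexp z)).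
      apply (Cderiv_mult _ _ _ _ _ D3 (Cderiv_cexp z)).
    + intros y. rewrite cexp_2pi. reflexivity.
    + intros z Hz.
      assert (N := cexp_neq_0 z).
      replace (k * V (cexp z) - k * c 0%nat)%C
        with (k * ((V (cexp z) - c 0%nat) / cexp z) * cexp z)%C by (field; exact N).
      rewrite !Cmod_mult, Cmod_cexp.
      apply Rmult_le_compat_r; [left; apply exp_pos|].
      apply Rmult_le_compat_l; [apply Cmod_ge_0|]. apply HM.
      rewrite Cmod_cexp. split; [apply exp_pos|].
      rewrite <- (exp_ln d) by auto. apply exp_increasing, Hz.
  - assert (I1 := IH _ _ j H1 Hj ltac:(lia)).
    assert (I2 := mean_negative_power (k * c 0%nat) j x).
    assert (I := is_RInt_plus (V := R_NormedModule) _ _ _ _ _ _ I1 I2).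
    change (plus (2 * PI * Re (k * c (S j))%C) 0) with (2 * PI * Re (k * c (S j))%C + 0) in I.
    rewrite Rplus_0_r in I.
    eapply is_RInt_ext; [|exact I]. intros t _.
    change (Re (k * ((V (cexp (x, t)) - c 0%nat) / cexp (x, t) * (/ cexp (x, t)) ^ j))%C
      + Re (k * c 0%nat * (/ cexp (x, t)) ^ S j)%C
      = Re (k * (V (cexp (x, t)) * (/ cexp (x, t)) ^ S j))%C).
    rewrite <- re_plus. apply (f_equal Re). rewrite Cpow_S. unfold Cdiv. ring.
Qed.

(** * Taylor polynomials and Bessel's inequality *)

Fixpoint psum (c : nat -> C) (z : C) (n : nat) : C :=
  match n with O => 0 | S m => psum c z m + c m * z ^ m end%C.

Lemma psum_first (c : nat -> C) (z : C) (n : nat) :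
  psum c z (S n) = (c 0%nat + z * psum (fun k => c (S k)) z n)%C.
Proof.
  induction n as [|n IH]; [simpl; ring|].
  change (psum c z (S n) + c (S n) * z ^ S n
    = c 0%nat + z * (psum (fun k => c (S k)) z n + c (S n) * z ^ n))%C.
  rewrite IH. simpl. ring.
Qed.

Lemma jet_psum (n : nat) (c : nat -> C) : jet n (fun z => psum c z n) c.
Proof.
  revert c; induction n as [|n IH]; intros c; [exact (bounded_const 0%C)|].
  eapply jet_ext; [| |apply (jet_zmult _ _ _ (c 0%nat) (IH (fun k => c (S k))))].
  - intros z _. symmetry. apply psum_first.
  - intros [|k] _; reflexivity.
Qed.

Lemma hol2_ext (f g : C -> C) : (forall z, f z = g z) -> hol2 f -> hol2 g.
Proof.
  intros E [f1 [f2 H]]. exists f1, f2. intros z Hz. destruct (H z Hz). split; auto.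
  eapply Cderiv_ext; eauto.
Qed.

Lemma hol2_psum (n : nat) (c : nat -> C) : hol2 (fun z => psum c z n).
Proof.
  revert c; induction n as [|n IH]; intros c; [exact (hol2_const 0%C)|].
  apply (hol2_ext (fun z => c 0%nat + z * psum (fun k => c (S k)) z n)%C).
  - intros z. symmetry. apply psum_first.
  - apply hol2_plus; [apply hol2_const|]. apply hol2_mult; [apply hol2_id|apply IH].
Qed.

Lemma rsum_nonneg (f : nat -> R) (n : nat) : (forall k, 0 <= f k) -> 0 <= rsum f n.
Proof. intros H. induction n as [|n IH]; simpl; [lra|]. specialize (H n). lra. Qed.

(* Integrate Re((2v - p) conj p) <= |v|^2, which is |v - p|^2 >= 0, over the
   circle |z| = r, where p is the Taylor polynomial of v. *)
Lemma bessel_circle (n : nat) (v : C -> C) (c : nat -> C) (x : R) :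
  hol2 v -> jet n v c -> (forall z, 0 < Cmod z < 1 -> Cmod (z * v z)%C < 1) -> x < 0 ->
  exp x ^ 2 * rsum (fun k => Cmod (c k) ^ 2 * exp x ^ (2 * k)) n <= 1.
Proof.
  intros Hol Hj Hv Hx.
  set (p := fun z => psum c z n).
  set (u := fun z => (2 * v z + - (1) * p z)%C).
  assert (Hu : hol2 u).
  { apply hol2_plus.
    - apply (hol2_mult (fun _ => 2%C)); [apply hol2_const|exact Hol].
    - apply (hol2_mult (fun _ => (- (1))%C)); [apply hol2_const|apply hol2_psum]. }
  assert (Ju : jet n u c).
  { eapply jet_ext; [| |apply (jet_plus _ _ _ _ _ (jet_scal n 2 _ _ Hj)
        (jet_scal n (- (1))%C _ _ (jet_psum n c)))].
    - reflexivity.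
    - intros k _. cbv beta. ring. }
  set (r := exp x). assert (Pr : 0 < r) by apply exp_pos.
  assert (I : forall N, (N <= n)%nat ->
     is_RInt (fun t => Re (u (cexp (x, t)) * Cconj (psum c (cexp (x, t)) N))%C) 0 (2 * PI)
       (2 * PI * rsum (fun k => Cmod (c k) ^ 2 * r ^ (2 * k)) N)).
  { induction N as [|N IHN]; intros HN.
    - apply (is_RInt_ext (fun _ => 0)).
      + intros t _. change (psum c (cexp (x, t)) 0) with (RtoC 0).
        replace (u (cexp (x, t)) * Cconj 0)%C with (RtoC 0); [reflexivity|].
        replace (Cconj 0) with (RtoC 0); [ring|].
        unfold Cconj, RtoC; simpl. f_equal; ring.
      + simpl rsum. assert (K := is_RInt_const (V := R_NormedModule) 0 (2 * PI) 0).
        change (scal (2 * PI - 0) 0) with ((2 * PI - 0) * 0) in K.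
        rewrite Rmult_0_r in *. exact K.
    - assert (I1 := IHN ltac:(lia)).
      (* On |z| = r the conjugate of z is r^2/z, so the conjugate of c_N z^N is this constant times
         z^(-N), and its product with u is covered by the coefficient formula. *)
      assert (I2 := mean_coef n u c N (Cconj (c N) * RtoC (r ^ (2 * N)))%C x Hu Ju ltac:(lia) Hx).
      assert (J := is_RInt_plus (V := R_NormedModule) _ _ _ _ _ _ I1 I2).
      assert (EN : Re (Cconj (c N) * RtoC (r ^ (2 * N)) * c N)%C = Cmod (c N) ^ 2 * r ^ (2 * N)).
      { replace (Cconj (c N) * RtoC (r ^ (2 * N)) * c N)%C
          with (c N * Cconj (c N) * RtoC (r ^ (2 * N)))%C by ring.
        rewrite <- Cmod2_conj, <- RtoC_mult. reflexivity. }
      rewrite EN in J.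
      match type of J with is_RInt _ _ _ ?l =>
        replace l with (2 * PI * rsum (fun k => Cmod (c k) ^ 2 * r ^ (2 * k)) (S N)) in J end.
      2:{ unfold plus; simpl. ring. }
      eapply is_RInt_ext; [|exact J]. intros t _.
      change (Re (u (cexp (x, t)) * Cconj (psum c (cexp (x, t)) N))%C +
        Re (Cconj (c N) * RtoC (r ^ (2 * N)) * (u (cexp (x, t)) * (/ cexp (x, t)) ^ N))%C
        = Re (u (cexp (x, t)) * Cconj (psum c (cexp (x, t)) N + c N * cexp (x, t) ^ N))%C).
      rewrite <- re_plus. apply (f_equal Re).
      rewrite Cplus_conj, Cmult_conj, Cpow_conj.
      assert (Ez : Cconj (cexp (x, t)) = (RtoC (r ^ 2) * / cexp (x, t))%C).
      { assert (N0 := cexp_neq_0 (x, t)).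
        replace (RtoC (r ^ 2)) with (cexp (x, t) * Cconj (cexp (x, t)))%C.
        - field. exact N0.
        - rewrite <- Cmod2_conj, Cmod_cexp. reflexivity. }
      rewrite Ez, Cpow_mult_l, <- RtoC_pow, <- pow_mult. ring. }
  assert (Pi := PI_RGT_0).
  (* The majorant 1/r^2 bounds |v|^2 on the circle, because |z v(z)| < 1 there. *)
  assert (L := is_RInt_le _ _ 0 (2 * PI) _ _ ltac:(lra) (I n (le_n n))
     (is_RInt_const (V := R_NormedModule) 0 (2 * PI) (/ r ^ 2))).
  change (scal (2 * PI - 0) (/ r ^ 2)) with ((2 * PI - 0) * / r ^ 2) in L.
  assert (Pr2 : 0 < r ^ 2) by (apply pow_lt; auto).
  assert (L' : rsum (fun k => Cmod (c k) ^ 2 * r ^ (2 * k)) n <= / r ^ 2).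
  { apply Rmult_le_reg_l with (2 * PI); [lra|].
    replace (2 * PI * / r ^ 2) with ((2 * PI - 0) * / r ^ 2) by ring. apply L.
    intros t _. clear L.
    assert (Hz := cexp_disk (x, t) Hx). assert (V := Hv _ Hz).
    assert (Ec : Cmod (cexp (x, t)) = r) by apply Cmod_cexp.
    rewrite Cmod_mult, Ec in V.
    unfold u, p. set (z := cexp (x, t)) in *. set (a := v z) in *. set (b := psum c z n).
    apply Rle_trans with (Cmod a ^ 2).
    - assert (S := pow2_ge_0 (Cmod (a - b)%C)).
      rewrite Cmod2_alt in S. rewrite Cmod2_alt.
      destruct a as [a1 a2], b as [b1 b2].
      unfold Re, Im, Cminus, Cplus, Copp, Cmult, Cconj, RtoC in *; cbn [fst snd] in *. nra.
    - apply Rmult_le_reg_l with (r ^ 2); auto. rewrite Rinv_r by lra.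
      pose proof (Cmod_ge_0 a).
      replace (r ^ 2 * Cmod a ^ 2) with ((r * Cmod a) * (r * Cmod a)) by ring.
      assert (0 <= r * Cmod a) by (apply Rmult_le_pos; lra). nra. }
  apply Rmult_le_compat_l with (r := r ^ 2) in L'; [|lra].
  rewrite Rinv_r in L' by lra. exact L'.
Qed.

(** The radius tends to 1: all weights r^(2k+2) with k < n are at least r^(2n+2), so r^(2n+2) S <= 1
    for every r < 1. If S > 1, the radius with r^(2n+2) = S^(-1/2) would give S^(1/2) <= 1. *)
Lemma bessel (n : nat) (v : C -> C) (c : nat -> C) :
  hol2 v -> jet n v c -> (forall z, 0 < Cmod z < 1 -> Cmod (z * v z)%C < 1) ->
  rsum (fun k => Cmod (c k) ^ 2) n <= 1.
Proof.
  intros Hol Hj Hv.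
  set (S := rsum (fun k => Cmod (c k) ^ 2) n).
  assert (S0 : 0 <= S) by (apply rsum_nonneg; intros; apply pow2_ge_0).
  assert (B : forall x, x < 0 -> exp x ^ (2 * n + 2) * S <= 1).
  { intros x Hx. eapply Rle_trans; [|apply (bessel_circle n v c x Hol Hj Hv Hx)].
    assert (P := exp_pos x).
    assert (P1 : exp x <= 1) by (rewrite <- exp_0; left; apply exp_increasing, Hx).
    rewrite pow_add, (Rmult_comm (exp x ^ (2 * n))), Rmult_assoc.
    apply Rmult_le_compat_l; [apply pow_le; lra|].
    unfold S. rewrite <- rsum_scal. apply rsum_le. intros k Hk.
    rewrite Rmult_comm. apply Rmult_le_compat_l; [apply pow2_ge_0|].
    replace (2 * n)%nat with (2 * k + 2 * (n - k))%nat by lia. rewrite pow_add.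
    rewrite <- (Rmult_1_r (exp x ^ (2 * k))) at 2.
    apply Rmult_le_compat_l; [apply pow_le; lra|].
    rewrite <- (pow1 (2 * (n - k))). apply pow_incr; lra. }
  destruct (Rle_dec S 1) as [H|H]; auto. exfalso.
  assert (Hm : 0 < INR (2 * n + 2)) by (apply lt_0_INR; lia).
  assert (Lp : 0 < ln S) by (rewrite <- ln_1; apply ln_increasing; lra).
  assert (Hx : - (ln S / (2 * INR (2 * n + 2))) < 0).
  { apply Ropp_lt_gt_0_contravar, Rdiv_lt_0_compat; lra. }
  specialize (B _ Hx).
  assert (E : exp (- (ln S / (2 * INR (2 * n + 2)))) ^ (2 * n + 2) = exp (- (ln S / 2))).
  { rewrite <- Rpower_pow by apply exp_pos. unfold Rpower. rewrite ln_exp. f_equal. field. lra. }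
  rewrite E in B. rewrite <- (exp_ln S) in B at 2 by lra. rewrite <- exp_plus in B.
  assert (1 < exp (- (ln S / 2) + ln S)).
  { rewrite <- exp_0. apply exp_increasing. lra. }
  lra.
Qed.

(** * The coefficient bounds *)

Lemma zfd_over_f_neq_0 (f fd : C -> C) (z : C) : z <> 0%C ->
  zfd_over_f f fd z = (z * fd z / f z)%C.
Proof.
  intros N. unfold zfd_over_f.
  destruct (Req_EM_T (Re z) 0) as [E1|N1]; auto.
  destruct (Req_EM_T (Im z) 0) as [E2|N2]; auto.
  exfalso. apply N. destruct z; unfold Re, Im, RtoC in *; simpl in *; congruence.
Qed.

(* Solving the chain rule for w' only needs G' <> 0, and the resulting formula
   for w' is again differentiable. *)
Lemma hol2_inner (a b g' : nat -> C) (w : C -> C) :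
  cvdisk a -> cvdisk b -> cvdisk g' ->
  (forall z, in_disk z -> PS b z <> 0%C) ->
  (forall z, in_disk z -> PS (dps g') z <> 0%C) ->
  analytic_disk w -> (forall z, in_disk z -> in_disk (w z)) ->
  (forall z, 0 < Cmod z < 1 -> PS a z = (PS b z * PS g' (w z))%C) ->
  hol2 w.
Proof.
  intros Ha Hb Hg Nb Ng Hw Bw E.
  assert (Ha1 := cvdisk_dps _ Ha). assert (Hb1 := cvdisk_dps _ Hb).
  assert (Hg1 := cvdisk_dps _ Hg).
  (* Writing a, b and g' for the sums of these series, a = b g'(w) differentiates to a' = b' g'(w) +
     b (g')'(w) w', so w' = N/Q with Q = b (g')'(w). *)
  set (N := fun z => (PS (dps a) z + - (1) * (PS (dps b) z * PS g' (w z)))%C).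
  set (Q := fun z => (PS b z * PS (dps g') (w z))%C).
  set (W := fun z => (N z / Q z)%C).
  assert (NQ : forall z, in_disk z -> Q z <> 0%C).
  { intros z Hz. apply Cmult_neq_0; auto. }
  assert (DW : forall z, 0 < Cmod z < 1 -> Cderiv w z (W z)).
  { intros z Hz. assert (Dz : in_disk z) by apply Hz.
    assert (Dw : exists l : C, Cderiv w z l).
    { destruct (Hw z Dz) as [l Hl]. exists l. apply Cderiv_iff, Hl. }
    destruct Dw as [l Hl].
    assert (D1 := Cderiv_comp (PS g') w z _ _ (PS_deriv g' _ Hg (Bw z Dz)) Hl).
    assert (D2 := Cderiv_mult _ _ z _ _ (PS_deriv b z Hb Dz) D1).
    (* This radius keeps z+h in the punctured disk, the domain of the functional equation. *)
    assert (P : 0 < Rmin (Cmod z) (1 - Cmod z)) by (apply Rmin_glb_lt; lra).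
    assert (D3 : Cderiv (PS a) z
      (PS (dps b) z * PS g' (w z) + PS b z * (PS (dps g') (w z) * l))%C).
    { refine (Cderiv_ext_loc _ _ z _ _ P _ D2). intros h Hh. symmetry. apply E.
      assert (B := Rmin_l (Cmod z) (1 - Cmod z)). assert (B' := Rmin_r (Cmod z) (1 - Cmod z)).
      split.
      - assert (T := Cmod_triangle (z + h)%C (- h)%C).
        replace (z + h + - h)%C with z in T by ring. rewrite Cmod_opp in T. lra.
      - eapply Rle_lt_trans; [apply Cmod_triangle|]. lra. }
    assert (U := Cderiv_unique _ _ _ _ D3 (PS_deriv a z Ha Dz)).
    replace (W z) with l; [exact Hl|].
    unfold W, N. rewrite <- U. unfold Q. field. split; auto. }
  exists W.
  exists (fun z =>
    let N1 := (PS (dps (dps a)) z + - (1) * (PS (dps (dps b)) z * PS g' (w z)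
                + PS (dps b) z * (PS (dps g') (w z) * W z)))%C in
    let Q1 := (PS (dps b) z * PS (dps g') (w z)
                + PS b z * (PS (dps (dps g')) (w z) * W z))%C in
    ((N1 * Q z - N z * Q1) / (Q z * Q z))%C).
  intros z Hz. split; [apply DW, Hz|].
  assert (Dz : in_disk z) by apply Hz. cbv zeta.
  assert (D1 := Cderiv_comp (PS g') w z _ _ (PS_deriv g' _ Hg (Bw z Dz)) (DW z Hz)).
  assert (D2 := Cderiv_comp (PS (dps g')) w z _ _ (PS_deriv _ _ Hg1 (Bw z Dz)) (DW z Hz)).
  apply Cderiv_div; [apply NQ, Dz| |].
  - apply Cderiv_plus; [apply PS_deriv; auto|].
    apply (Cderiv_comp (fun u => - (1) * u)%C (fun z => PS (dps b) z * PS g' (w z))%C);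
      [apply Cderiv_scal|].
    apply (Cderiv_mult (PS (dps b)) (fun z => PS g' (w z))); [apply PS_deriv; auto|exact D1].
  - apply (Cderiv_mult (PS b) (fun z => PS (dps g') (w z))); [apply PS_deriv; auto|exact D2].
Qed.

(* The hypothesis is equivalent to v = 2 (A1 - B1) - 2 z v (v S2 + B1 S1), with
   A1, B1, S1, S2 as in the proof, and the factor z gains one order of the jet
   at each use. *)
Lemma jet_inverse (a b : nat -> C) (v : C -> C) (n : nat) :
  cvdisk a -> cvdisk b -> a 0%nat = 1%C -> b 0%nat = 1%C ->
  bounded_near0 v -> (forall z, 0 < Cmod z < 1 -> in_disk (z * v z)%C) ->
  (forall z, 0 < Cmod z < 1 -> PS a z = (PS b z * PS g (z * v z))%C) ->
  exists c, jet n v c.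
Proof.
  intros Ha Hb a0 b0 Bv Dv E.
  assert (Ha1 := proj1 (cvdisk_shift _) Ha). assert (Hb1 := proj1 (cvdisk_shift _) Hb).
  assert (Hg1 := proj1 (cvdisk_shift _) cvdisk_g). assert (Hg2 := proj1 (cvdisk_shift _) Hg1).
  induction n as [|n [c IH]].
  - exists (fun _ => 0%C). exact Bv.
  - assert (J1 := jet_weaken _ _ _ (jet_comp n v _ c IH Hg1)).
    assert (J2 := jet_weaken _ _ _ (jet_comp n v _ c IH Hg2)).
    assert (K1 := jet_mult _ _ _ _ _ IH (jet_plus _ _ _ _ _ (jet_mult _ _ _ _ _ IH J2)
                    (jet_mult _ _ _ _ _ (jet_PS n _ Hb1) J1))).
    assert (K2 := jet_scal _ (- (2))%C _ _ (jet_zmult _ _ _ 0%C K1)).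
    assert (K3 := jet_scal _ 2%C _ _ (jet_plus _ _ _ _ _ (jet_PS (S n) _ Ha1)
                    (jet_scal _ (- (1))%C _ _ (jet_PS (S n) _ Hb1)))).
    assert (K4 := jet_plus _ _ _ _ _ K3 K2).
    eexists. eapply jet_ext_near; [exact Rlt_0_1| |reflexivity|exact K4].
    intros z Hz. cbv beta. assert (Dz : in_disk z) by apply Hz.
    assert (Nz : z <> 0%C) by apply Cmod_gt_0, Hz.
    specialize (E z Hz). specialize (Dv z Hz).
    rewrite (PS_incr a z), (PS_incr b z), (PS_incr g (z * v z)%C), a0, b0 in E
      by auto using cvdisk_g.
    assert (E2 := PS_incr _ (z * v z)%C Hg1 Dv). cbv beta in E2.
    set (S1 := PS (fun k => g (S k)) (z * v z)) in *.
    set (S2 := PS (fun k => g (S (S k))) (z * v z)) in *.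
    set (A1 := PS (fun k => a (S k)) z) in *. set (B1 := PS (fun k => b (S k)) z) in *.
    rewrite g_1, RtoC_inv in E2 by lra. change (g 0%nat) with (RtoC 1) in E.
    (* Both series start with 1 and so does G: subtracting 1 + z B1 from the relation leaves a
       multiple of z, which is divided out. *)
    assert (E3 : (A1 - B1 = (1 + z * B1) * (v z * S1))%C).
    { apply (f_equal (fun u => (u - (1 + z * B1)) / z))%C in E.
      replace ((1 + z * A1 - (1 + z * B1)) / z)%C with (A1 - B1)%C in E by (field; auto).
      rewrite E. field. exact Nz. }
    replace (2 * (A1 + - (1) * B1))%C with (2 * (A1 - B1))%C by ring.
    rewrite E3. rewrite E2 at 1.
    replace (2 * ((1 + z * B1) * (v z * (/ 2 + z * v z * S2))))%C
      with (2 * (/ 2 * v z + v z * z * v z * S2 + z * B1 * v z * (/ 2 + z * v z * S2)))%C by ring.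
    rewrite <- E2. field.
Qed.

(** The subordination, cleared of denominators, reads f'(z) = (f(z)/z) G(z v(z)) with v(z) = w(z)/z.
    Both sides have a jet of order 6, the left one from the power series of f, the right one from
    the jet of v; uniqueness equates them. Five coefficients of v suffice, since composing with G
    gains one order. *)
Lemma schwarz_coef (f : C -> C) (a : nat -> C) : class_SG f -> coeffs_of f a ->
  exists c : nat -> C, rsum (fun k => Cmod (c k) ^ 2) 5 <= 1 /\ a 1%nat = 1%C /\
    forall k, (k < 6)%nat ->
      dps a k = conv (fun k => a (S k)) (comp_coef 6 g c) k.
Proof.
  intros [[[_ Uf] [f0 f1]] [fd [Hfd [w [Hw [w0 [w1 Ew]]]]]]] Ca.
  destruct (pseries_cvdisk f a Ca) as [Ha Ef].
  assert (D0 : in_disk 0%C) by (unfold in_disk; rewrite Cmod_0; lra).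
  assert (a0 : a 0%nat = 0%C) by (rewrite <- (PS_0 a Ha), <- Ef; auto).
  assert (Efd : forall z, in_disk z -> fd z = PS (dps a) z).
  { intros z Hz. assert (D := Hfd z Hz). apply Cderiv_iff in D.
    apply (Cderiv_unique f z); auto. unfold in_disk in Hz.
    apply (Cderiv_ext_loc (PS a) f z _ (1 - Cmod z)); [lra| |apply PS_deriv; auto].
    intros h Hh. symmetry. apply Ef. unfold in_disk.
    eapply Rle_lt_trans; [apply Cmod_triangle|]. lra. }
  assert (Hda := cvdisk_dps _ Ha). assert (Hs := proj1 (cvdisk_shift a) Ha).
  set (s := fun k => a (S k)) in *.
  assert (da0 : dps a 0%nat = 1%C).
  { rewrite <- (PS_0 _ Hda), <- Efd by auto.
    apply (Cderiv_unique f 0%C); apply Cderiv_iff; auto. }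
  assert (a1 : s 0%nat = 1%C).
  { rewrite <- da0. unfold dps, s. simpl. ring. }
  assert (EfA : forall z, in_disk z -> f z = (z * PS s z)%C).
  { intros z Hz. rewrite Ef, PS_incr, a0 by auto. fold s. ring. }
  (* Univalence enters: a zero of f(z)/z away from 0 would be a second zero of f, and the value at 0
     is 1. *)
  assert (NA : forall z, in_disk z -> PS s z <> 0%C).
  { intros z Hz Q. destruct (Ceq_dec z 0) as [->|N].
    - rewrite PS_0, a1 in Q by auto. exact (C1_nz Q).
    - apply N, Uf; auto. rewrite f0, EfA, Q by auto. ring. }
  assert (Rel : forall z, 0 < Cmod z < 1 -> PS (dps a) z = (PS s z * PS g (w z))%C).
  { intros z Hz. assert (Dz : in_disk z) by apply Hz.
    assert (Nz : z <> 0%C) by apply Cmod_gt_0, Hz.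
    assert (E := Ew z Dz).
    rewrite Psi_series, zfd_over_f_neq_0, EfA, Efd in E by (auto; apply w1, Dz).
    rewrite <- E. field. split; auto. }
  set (v := fun z => (w z * / z)%C).
  assert (Ev : forall z, 0 < Cmod z < 1 -> (z * v z = w z)%C).
  { intros z Hz. unfold v. field. apply Cmod_gt_0, Hz. }
  assert (Hol : hol2 v).
  { apply hol2_mult; [|apply hol2_inv].
    apply (hol2_inner (dps a) s g w); auto using cvdisk_g.
    apply dG_neq_0. }
  assert (Bv : bounded_near0 v).
  { destruct (Hw _ D0) as [l Hl]. apply Cderiv_iff in Hl.
    destruct (Cderiv_lip _ _ _ Hl) as [d [Hd K]].
    exists (Cmod l + 1), d. split; auto. intros z Hz. specialize (K z (proj2 Hz)).
    rewrite Cplus_0_l, w0 in K. unfold Cminus in K. rewrite Copp_0, Cplus_0_r in K.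
    unfold v. rewrite Cmod_mult, Cmod_inv by (apply Cmod_gt_0, Hz).
    apply Rmult_le_reg_r with (Cmod z); [lra|].
    rewrite Rmult_assoc, Rinv_l by lra. lra. }
  assert (Vd : forall z, 0 < Cmod z < 1 -> Cmod (z * v z)%C < 1).
  { intros z Hz. rewrite Ev by auto. apply w1. apply Hz. }
  assert (RelV : forall z, 0 < Cmod z < 1 -> PS (dps a) z = (PS s z * PS g (z * v z))%C).
  { intros z Hz. rewrite Ev by auto. auto. }
  destruct (jet_inverse (dps a) s v 5) as [c Jc]; auto.
  exists c. split; [apply (bessel 5 v c); auto|]. split; [exact a1|].
  apply (jet_unique 6 (PS (dps a))); [apply jet_PS; auto|].
  eapply jet_ext_near; [exact Rlt_0_1| |reflexivity|
    exact (jet_mult _ _ _ _ _ (jet_PS 6 s Hs) (jet_comp 5 v g c Jc cvdisk_g))].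
  intros z Hz. symmetry. apply RelV, Hz.
Qed.

Lemma beta_values : beta 0 = 1 / 2 /\ beta 1 = 1 / 12 /\ beta 2 = 1 / 24 /\
  beta 3 = 19 / 720 /\ beta 4 = 3 / 160.
Proof.
  assert (B0 : beta 0 = 1 / 2) by (rewrite beta_eq; simpl; field).
  assert (B1 : beta 1 = 1 / 12) by (rewrite beta_eq; cbn [rsum]; rewrite B0; simpl; field).
  assert (B2 : beta 2 = 1 / 24) by (rewrite beta_eq; cbn [rsum]; rewrite B0, B1; simpl; field).
  assert (B3 : beta 3 = 19 / 720) by (rewrite beta_eq; cbn [rsum]; rewrite B0, B1, B2; simpl; field).
  assert (B4 : beta 4 = 3 / 160) by (rewrite beta_eq; cbn [rsum]; rewrite B0, B1, B2, B3; simpl; field).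
  auto.
Qed.

Lemma g_values : g 0%nat = 1%C /\ g 1%nat = (1 / 2)%C /\ g 2%nat = (- (1 / 12))%C /\
  g 3%nat = (1 / 24)%C /\ g 4%nat = (- (19 / 720))%C /\ g 5%nat = (3 / 160)%C.
Proof.
  destruct beta_values as [B0 [B1 [B2 [B3 B4]]]].
  cbn [g scons]. rewrite B0, B1, B2, B3, B4.
  rewrite <- !RtoC_div by lra. rewrite <- !RtoC_opp.
  repeat split; f_equal; field.
Qed.

(** The coefficient of z^k gives k a_(k+1) = g_1 c_(k-1) + ..., where the dots involve earlier c_j
    only once the earlier a_j are eliminated. The factor 2k on the left compensates g_1 = 1/2 and
    gives the newest coefficient the factor 1. *)
Lemma coef_formulas (a c : nat -> C) : a 1%nat = 1%C ->
  (forall k, (k < 6)%nat -> dps a k = conv (fun k => a (S k)) (comp_coef 6 g c) k) ->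
  (2 * a 2%nat = c 0%nat /\
   4 * a 3%nat = c 1%nat + 1 / 3 * c 0%nat * c 0%nat /\
   6 * a 4%nat = c 2%nat + 5 / 12 * c 0%nat * c 1%nat + 1 / 12 * c 0%nat * c 0%nat * c 0%nat /\
   8 * a 5%nat = c 3%nat + 1 / 3 * c 0%nat * c 2%nat + 1 / 12 * c 1%nat * c 1%nat
      + 7 / 36 * c 0%nat * c 0%nat * c 1%nat
      + - (1 / 90) * c 0%nat * c 0%nat * c 0%nat * c 0%nat /\
   10 * a 6%nat = c 4%nat + 7 / 24 * c 0%nat * c 3%nat + 1 / 12 * c 1%nat * c 2%nat
      + 13 / 72 * c 0%nat * c 0%nat * c 2%nat + 47 / 288 * c 0%nat * c 1%nat * c 1%nat
      + - (287 / 4320) * c 0%nat * c 0%nat * c 0%nat * c 1%nat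
      + 31 / 2160 * c 0%nat * c 0%nat * c 0%nat * c 0%nat * c 0%nat)%C.
Proof.
  intros a1 E.
  destruct g_values as [G0 [G1 [G2 [G3 [G4 G5]]]]].
  assert (E1 := E 1%nat ltac:(lia)). assert (E2 := E 2%nat ltac:(lia)).
  assert (E3 := E 3%nat ltac:(lia)). assert (E4 := E 4%nat ltac:(lia)).
  assert (E5 := E 5%nat ltac:(lia)). clear E.
  unfold dps in *.
  cbn [conv comp_coef scons] in E1, E2, E3, E4, E5.
  rewrite ?G0, ?G1, ?G2, ?G3, ?G4, ?G5, a1, INR_IZR_INZ in *. simpl Z.of_nat in *.
  set (c0 := c 0%nat) in *. set (c1 := c 1%nat) in *. set (c2 := c 2%nat) in *.
  set (c3 := c 3%nat) in *. set (c4 := c 4%nat) in *.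
  set (a2 := a 2%nat) in *. set (a3 := a 3%nat) in *. set (a4 := a 4%nat) in *.
  set (a5 := a 5%nat) in *. set (a6 := a 6%nat) in *.
  clearbody c0 c1 c2 c3 c4 a2 a3 a4 a5 a6. clear - E1 E2 E3 E4 E5.
  (* Each new a_n stands on both sides of its equation, with factors n and 1; forming n a_n - a_n
     isolates it. *)
  assert (F2 : a2 = (c0 / 2)%C).
  { replace a2 with (2 * a2 - a2)%C at 1 by ring. rewrite E1. field. }
  assert (F3 : a3 = (c1 / 4 + 1 / 12 * c0 * c0)%C).
  { replace a3 with ((3 * a3 - a3) / 2)%C at 1 by field. rewrite E2, F2. field. }
  assert (F4 : a4 = ((c2 + 5 / 12 * c0 * c1 + 1 / 12 * c0 * c0 * c0) / 6)%C).
  { replace a4 with ((4 * a4 - a4) / 3)%C at 1 by field. rewrite E3, F2, F3. field. }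
  assert (F5 : a5 = ((c3 + 1 / 3 * c0 * c2 + 1 / 12 * c1 * c1 + 7 / 36 * c0 * c0 * c1
      + - (1 / 90) * c0 * c0 * c0 * c0) / 8)%C).
  { replace a5 with ((5 * a5 - a5) / 4)%C at 1 by field. rewrite E4, F2, F3, F4. field. }
  repeat split.
  - rewrite F2. field.
  - rewrite F3. field.
  - rewrite F4. field.
  - rewrite F5. field.
  - replace (10 * a6)%C with (2 * (6 * a6 - a6))%C by ring. rewrite E5, F2, F3, F4, F5. field.
Qed.

Ltac Cmod_poly_bound :=
  repeat (eapply Rle_trans; [apply Cmod_triangle|apply Rplus_le_compat]);
  rewrite ?Cmod_mult, ?Cmod_opp, <- ?RtoC_div, ?Cmod_R, ?Rabs_pos_eq by lra;
  apply Rle_refl.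

Lemma Cmod_scaled_le (r b : R) (x y : C) : 0 < r ->
  (RtoC r * x = y)%C -> Cmod y <= b -> Cmod x <= b / r.
Proof.
  intros Hr E H. rewrite <- E, Cmod_mult, Cmod_R, Rabs_pos_eq in H by lra.
  apply Rmult_le_reg_l with r; auto. replace (r * (b / r)) with b by (field; lra). exact H.
Qed.

Lemma coef_bounds (f : C -> C) (a : nat -> C) : class_SG f -> coeffs_of f a ->
  (forall n : nat, (2 <= n <= 5)%nat -> Cmod (a n) <= 1 / (2 * (INR n - 1))) /\
  Cmod (a 6%nat) <= 13 / 48.
Proof.
  intros Hf Ha.
  destruct (schwarz_coef f a Hf Ha) as [c [Hc [a1 E]]].
  destruct (coef_formulas a c a1 E) as [F2 [F3 [F4 [F5 F6]]]]. clear E.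
  cbn [rsum] in Hc. rewrite Rplus_0_l in Hc.
  set (c0 := c 0%nat) in *. set (c1 := c 1%nat) in *. set (c2 := c 2%nat) in *.
  set (c3 := c 3%nat) in *. set (c4 := c 4%nat) in *.
  assert (P0 := Cmod_ge_0 c0). assert (P1 := Cmod_ge_0 c1). assert (P2 := Cmod_ge_0 c2).
  assert (P3 := Cmod_ge_0 c3). assert (P4 := Cmod_ge_0 c4).
  assert (B3 : Cmod (c1 + 1 / 3 * c0 * c0)%C <= Cmod c1 + 1 / 3 * Cmod c0 * Cmod c0)
    by Cmod_poly_bound.
  assert (B4 : Cmod (c2 + 5 / 12 * c0 * c1 + 1 / 12 * c0 * c0 * c0)%C
     <= Cmod c2 + 5 / 12 * Cmod c0 * Cmod c1 + 1 / 12 * Cmod c0 * Cmod c0 * Cmod c0)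
    by Cmod_poly_bound.
  assert (B5 : Cmod (c3 + 1 / 3 * c0 * c2 + 1 / 12 * c1 * c1 + 7 / 36 * c0 * c0 * c1
      + - (1 / 90) * c0 * c0 * c0 * c0)%C
     <= Cmod c3 + 1 / 3 * Cmod c0 * Cmod c2 + 1 / 12 * Cmod c1 * Cmod c1
      + 7 / 36 * Cmod c0 * Cmod c0 * Cmod c1
      + 1 / 90 * Cmod c0 * Cmod c0 * Cmod c0 * Cmod c0)
    by Cmod_poly_bound.
  assert (B6 : Cmod (c4 + 7 / 24 * c0 * c3 + 1 / 12 * c1 * c2
      + 13 / 72 * c0 * c0 * c2 + 47 / 288 * c0 * c1 * c1
      + - (287 / 4320) * c0 * c0 * c0 * c1
      + 31 / 2160 * c0 * c0 * c0 * c0 * c0)%C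
     <= Cmod c4 + 7 / 24 * Cmod c0 * Cmod c3 + 1 / 12 * Cmod c1 * Cmod c2
      + 13 / 72 * Cmod c0 * Cmod c0 * Cmod c2 + 47 / 288 * Cmod c0 * Cmod c1 * Cmod c1
      + 287 / 4320 * Cmod c0 * Cmod c0 * Cmod c0 * Cmod c1
      + 31 / 2160 * Cmod c0 * Cmod c0 * Cmod c0 * Cmod c0 * Cmod c0)
    by Cmod_poly_bound.
  set (x0 := Cmod c0) in *. set (x1 := Cmod c1) in *. set (x2 := Cmod c2) in *.
  set (x3 := Cmod c3) in *. set (x4 := Cmod c4) in *.
  (* From x <= (1 + x^2)/2. Applied with x the newest coefficient and s the sum of the earlier
     squares, it leaves room s/2 for the other monomials. *)
  assert (L : forall x s, 0 <= s -> x ^ 2 + s <= 1 -> x <= 1 - s / 2) by (intros; nra).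
  assert (T : forall x, 0 <= x -> x ^ 2 <= 1 -> x <= 1) by (intros; nra).
  assert (Q0 := pow2_ge_0 x0). assert (Q1 := pow2_ge_0 x1). assert (Q2 := pow2_ge_0 x2).
  assert (Q3 := pow2_ge_0 x3). assert (Q4 := pow2_ge_0 x4).
  assert (T0 : x0 <= 1) by (apply T; lra). assert (T1 : x1 <= 1) by (apply T; lra).
  assert (T2 : x2 <= 1) by (apply T; lra). assert (T3 : x3 <= 1) by (apply T; lra).
  assert (T4 : x4 <= 1) by (apply T; lra).
  (* [M] lowers the degree of a monomial by dropping a factor at most 1, and [G] turns mixed
     quadratic terms into squares. The comparison with s/2 is then linear in the monomials. *)
  assert (M : forall x y, 0 <= x <= 1 -> 0 <= y -> 0 <= x * y <= y) by (intros; nra).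
  assert (G : forall x y, x * y <= (x ^ 2 + y ^ 2) / 2)
    by (intros x y; assert (H := pow2_ge_0 (x - y)); nra).
  assert (G01 := G x0 x1). assert (G02 := G x0 x2).
  assert (S0 : 0 <= x0 * x0 <= x0) by (apply M; lra).
  assert (S00 : 0 <= x0 * (x0 * x0) <= x0 * x0) by (apply M; lra).
  assert (S000 : 0 <= x0 * (x0 * (x0 * x0)) <= x0 * (x0 * x0)) by (apply M; lra).
  assert (S01 : 0 <= x0 * x1 <= x1) by (apply M; lra).
  assert (S001 : 0 <= x0 * (x0 * x1) <= x0 * x1) by (apply M; lra).
  assert (N2 : Cmod (a 2%nat) <= 1 / 2).
  { apply (Cmod_scaled_le 2 1 _ _ ltac:(lra) F2). exact T0. }
  assert (N3 : Cmod (a 3%nat) <= 1 / 4).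
  { apply (Cmod_scaled_le 4 1 _ _ ltac:(lra) F3). eapply Rle_trans; [exact B3|].
    assert (K := L x1 (x0 ^ 2) ltac:(lra) ltac:(lra)). nra. }
  assert (N4 : Cmod (a 4%nat) <= 1 / 6).
  { apply (Cmod_scaled_le 6 1 _ _ ltac:(lra) F4). eapply Rle_trans; [exact B4|].
    assert (K := L x2 (x0 ^ 2 + x1 ^ 2) ltac:(lra) ltac:(lra)).
    replace (x0 ^ 2) with (x0 * x0) in * by ring. lra. }
  assert (N5 : Cmod (a 5%nat) <= 1 / 8).
  { apply (Cmod_scaled_le 8 1 _ _ ltac:(lra) F5). eapply Rle_trans; [exact B5|].
    assert (K := L x3 (x0 ^ 2 + x1 ^ 2 + x2 ^ 2) ltac:(lra) ltac:(lra)).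
    replace (x0 ^ 2) with (x0 * x0) in * by ring.
    replace (x1 ^ 2) with (x1 * x1) in * by ring. lra. }
  split.
  - intros n Hn. destruct n as [|[|[|[|[|[|n]]]]]]; try lia; simpl INR.
    + replace (1 / (2 * (1 + 1 - 1))) with (1 / 2) by field. exact N2.
    + replace (1 / (2 * (1 + 1 + 1 - 1))) with (1 / 4) by field. exact N3.
    + replace (1 / (2 * (1 + 1 + 1 + 1 - 1))) with (1 / 6) by field. exact N4.
    + replace (1 / (2 * (1 + 1 + 1 + 1 + 1 - 1))) with (1 / 8) by field. exact N5.
  - replace (13 / 48) with (65 / 24 / 10) by field.
    (* Each monomial is at most 1 because every |c_k| is, and the coefficients of the majorant add
       up to less than 2, well below 65/24 = 10 * 13/48. *)
    apply (Cmod_scaled_le 10 (65 / 24) _ _ ltac:(lra) F6). eapply Rle_trans; [exact B6|].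
    assert (S03 : 0 <= x0 * x3 <= x3) by (apply M; lra).
    assert (S12 : 0 <= x1 * x2 <= x2) by (apply M; lra).
    assert (S02 : 0 <= x0 * x2 <= x2) by (apply M; lra).
    assert (S002 : 0 <= x0 * (x0 * x2) <= x0 * x2) by (apply M; lra).
    assert (S11 : 0 <= x1 * x1 <= x1) by (apply M; lra).
    assert (S011 : 0 <= x0 * (x1 * x1) <= x1 * x1) by (apply M; lra).
    assert (S0001 : 0 <= x0 * (x0 * (x0 * x1)) <= x0 * (x0 * x1)) by (apply M; lra).
    assert (S0000 : 0 <= x0 * (x0 * (x0 * (x0 * x0))) <= x0 * (x0 * (x0 * x0)))
      by (apply M; lra).
    lra.
Qed.

Theorem theorem1 :
  (forall (f : C -> C) (a : nat -> C), class_SG f -> coeffs_of f a ->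
     (forall n : nat, (2 <= n <= 5)%nat -> Cmod (a n) <= 1 / (2 * (INR n - 1))) /\
     Cmod (a 6%nat) <= 13 / 48) /\
  (forall n : nat, (2 <= n <= 5)%nat ->
     exists (f : C -> C) (a : nat -> C), class_SG f /\ coeffs_of f a /\
       Cmod (a n) = 1 / (2 * (INR n - 1))).
Proof. split; [exact coef_bounds|exact sharp_examples]. Qed.
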